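(* Fix a positive integer $w$. For every $\epsilon>0$ there is an $S$ such that for every finite poset $P$ of width at most $w$ and every $x\in P$ with $\sigma(x)>S$, we have $\delta_x>1/2-\epsilon$. In particular, for every $\epsilon>0$ there is an $S'$ such that every finite poset $P$ of width at most $w$ with $\sigma(P)>S'$ satisfies $\delta(P)>1/2-\epsilon$.
   Context: All posets are finite. The width $w(P)$ is the maximum size of an antichain of $P$. For an $n$-element poset $P$, a linear extension is an order-preserving bijection $f:P\to[n]$ (equivalently a linear order $\prec$ on $P$ extending the order of $P$); $f$ (or $\prec$) denotes a uniformly random linear extension. For distinct $x,y\in P$, $\delta_{xy}=\min\{\mathbb{P}(x\prec y),\mathbb{P}(y\prec x)\}$; $\delta_x=\max_{y\ne x}\delta_{xy}$; $\delta(P)=\max\delta_{xy}$ over distinct $x,y\in P$. $\sigma(x)$ is the standard deviation of $f(x)$, and $\sigma(P)=\max_{x\in P}\sigma(x)$. *)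

(* Defs.v *)
From HB Require Import structures.
From mathcomp Require Import all_boot all_order all_algebra.
From mathcomp Require Import reals.

Set Implicit Arguments.
Unset Strict Implicit.
Unset Printing Implicit Defensive.

Import Order.TTheory GRing.Theory Num.Theory.
Local Open Scope ring_scope.

Section Posets.
Context {d : Order.disp_t} (P : finPOrderType d).

Definition antichain (A : {set P}) : bool :=
  [forall x in A, forall y in A, (x != y) ==> (x >< y)%O].

Definition width : nat := \max_(A : {set P} | antichain A) #|A|.

(* [n] is encoded as 'I_n, i.e. {0, ..., n-1}; the shift back to {1, ..., n}
   is made in [position]. Since the two sides have the same cardinality,
   bijectivity amounts to injectivity, see [linextsP]. *)
Definition linexts : {set {ffun P -> 'I_#|P|}} :=
  [set f : {ffun P -> 'I_#|P|} |
    injectiveb f && [forall x, forall y, (x <= y)%O ==> (f x <= f y)%N]].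

Lemma linextsP (f : {ffun P -> 'I_#|P|}) :
  reflect (bijective f /\ (forall x y : P, (x <= y)%O -> (f x <= f y)%N))
          (f \in linexts).
Proof.
rewrite inE; apply: (iffP andP) => -[fbij fhomo]; split.
- by apply: inj_card_bij; [exact/injectiveP|rewrite card_ord].
- by move=> x y; move/forallP/(_ x)/forallP/(_ y)/implyP: fhomo; apply.
- exact/injectiveP/bij_inj.
- by apply/forallP => x; apply/forallP => y; apply/implyP; exact: fhomo.
Qed.

Definition position (f : {ffun P -> 'I_#|P|}) (x : P) : nat := (f x).+1.

Variable R : realType.

(* Probability and expectation under the uniform law on [linexts]. *)
Definition lin_prob (E : pred {ffun P -> 'I_#|P|}) : R :=
  #|[set f in linexts | E f]|%:R / #|linexts|%:R.

Definition lin_expect (X : {ffun P -> 'I_#|P|} -> R) : R :=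
  (\sum_(f in linexts) X f) / #|linexts|%:R.

Definition prec_prob (x y : P) : R :=
  lin_prob (fun f => (position f x < position f y)%N).

(* All quantities maximized below are nonnegative, so the default value 0 of
   the iterated maximum only matters when the index set is empty. *)
Definition delta2 (x y : P) : R := Num.min (prec_prob x y) (prec_prob y x).

Definition delta_elt (x : P) : R := \big[Num.max/0]_(y : P | y != x) delta2 x y.

Definition delta_poset : R :=
  \big[Num.max/0]_(p : P * P | p.1 != p.2) delta2 p.1 p.2.

Definition mean_position (x : P) : R := lin_expect (fun f => (position f x)%:R).

Definition sigma_elt (x : P) : R :=
  Num.sqrt (lin_expect (fun f => ((position f x)%:R - mean_position x) ^+ 2)).

Definition sigma_poset : R := \big[Num.max/0]_(x : P) sigma_elt x.

End Posets.

(* Main.v *)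
Require Import Defs.
From mathcomp Require Import boolp classical_sets topology normedtype derive.
From mathcomp Require Import all_boot all_order all_algebra.
From mathcomp Require Import reals.
From mathcomp Require Import ring lra zify.

(**
Let [D] be the set of elements below [x] in a random linear extension.  If no
[P(y < x)] lies within [eps] of 1/2, put [A := {y | P(y < x) > 1/2}].

The law of [D] is log-supermodular: the number of order-preserving maps into a
long chain is so by the four functions theorem, and its leading coefficient
counts linear extensions.  For [a] in [A] and [b] outside [A], the event
[a \in D, b \notin D] has probability at least [2 eps].  Intersecting sets [D]
over the at most [w] minimal [b], then taking unions over the at most [w] maximal
[a], the four functions theorem yields [P(D = A) >= (2 eps)^((w+1)^2)], so the
position of [x] has an atom of mass bounded below.

The law of the position of [x] is log-concave (Stanley).  This is proved with the
combinatorial atlas of Chan and Pak: a symmetric nonnegative matrix all of whose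
"links" have one positive eigenvalue has one positive eigenvalue itself.  A
log-concave law with a large atom has bounded variance.
*)

Set Implicit Arguments.
Unset Strict Implicit.
Unset Printing Implicit Defensive.
Import Order.TTheory GRing.Theory Num.Theory.
Import numFieldNormedType.Exports.
Local Open Scope ring_scope.

(** * Forms with a single positive direction *)

(** Linear extensions cannot be combined by pointwise maximum and minimum, since injectivity is
    lost, while order-preserving maps into a chain form a lattice under these operations. This is
    why log-supermodularity goes through maps, whose ties become negligible as the chain grows. The
    poset has unboundedly many elements, so a union bound over all pairs [a], [b] is useless. The
    four functions theorem replaces it by a product, and since [D] is down-closed, only the minimal
    [b] and the maximal [a] have to be controlled; the width bounds their number. For Stanley's
    inequality the obstacle is vanishing counts: the equality case of the eigenvalue argument needs
    a connected matrix. Removals in the unwanted direction are therefore given a small weight [eps].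
    Zeros may return in the limit, so log-concavity is carried in a four-index form that rules out
    zeros between nonzero terms. *)

Section BilinearForm.
Variables (R : realType) (I : finType) (M : I -> I -> R).

Definition mxact (v : I -> R) (i : I) : R := \sum_j M i j * v j.
Definition bform (v w : I -> R) : R := \sum_i v i * mxact w i.

Lemma mxactD v w i : mxact (fun i => v i + w i) i = mxact v i + mxact w i.
Proof. by rewrite -big_split /=; apply: eq_bigr => j _; rewrite mulrDr. Qed.

Lemma mxactZ a v i : mxact (fun i => a * v i) i = a * mxact v i.
Proof. by rewrite big_distrr /=; apply: eq_bigr => j _; rewrite mulrCA. Qed.

Lemma bformDr v w w' : bform v (fun i => w i + w' i) = bform v w + bform v w'.
Proof.
by rewrite -big_split /=; apply: eq_bigr => i _; rewrite mxactD mulrDr.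
Qed.

Lemma bformZr a v w : bform v (fun i => a * w i) = a * bform v w.
Proof. by rewrite big_distrr /=; apply: eq_bigr => i _; rewrite mxactZ mulrCA. Qed.

Hypothesis Msym : forall i j, M i j = M j i.

Lemma bformC v w : bform v w = bform w v.
Proof.
rewrite /bform /mxact.
under eq_bigr do rewrite big_distrr /=.
rewrite exchange_big /=; apply: eq_bigr => i _.
by rewrite big_distrr /=; apply: eq_bigr => j _; rewrite (Msym j i); ring.
Qed.

Lemma bformDl v v' w : bform (fun i => v i + v' i) w = bform v w + bform v' w.
Proof. by rewrite bformC bformDr !(bformC w). Qed.

Lemma bformZl a v w : bform (fun i => a * v i) w = a * bform v w.
Proof. by rewrite bformC bformZr bformC. Qed.

Lemma bform_comb a b v w :
  bform (fun i => a * v i + b * w i) (fun i => a * v i + b * w i) =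
  a ^+ 2 * bform v v + 2 * a * b * bform v w + b ^+ 2 * bform w w.
Proof.
rewrite bformDl !bformDr !bformZl !bformZr (bformC w v); ring.
Qed.

(** If [v] and [w] had positive squares and the inequality failed, the form would be positive
    definite on their span. But the span meets the hyperplane orthogonal to [h] in the combination
    [bform w h * v - bform v h * w]. *)
Lemma hyperbolic_of_hyperplane (h : I -> R) :
  (forall v, bform v h = 0 -> bform v v <= 0) ->
  forall v w, 0 <= bform w w -> bform v v * bform w w <= bform v w ^+ 2.
Proof.
move=> neg v w; rewrite le_eqVlt => /orP[/eqP<-|w_gt0].
  by rewrite mulr0 sqr_ge0.
have [v_le0|v_gt0] := lerP (bform v v) 0.
  by rewrite (le_trans _ (sqr_ge0 _)) // mulr_le0_ge0 // ltW.
have wh : bform w h != 0.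
  by apply/negP => /eqP/neg; rewrite leNgt w_gt0.
have := neg (fun i => bform w h * v i + (- bform v h) * w i).
rewrite bformDl !bformZl bform_comb mulNr mulrC subrr => /(_ erefl) le0.
have a2_gt0 : 0 < bform w h ^+ 2 by rewrite exprn_even_gt0.
rewrite leNgt; apply/negP => lt; move: le0; apply/negP; rewrite -ltNge.
rewrite -(pmulr_rgt0 _ v_gt0).
have -> : bform v v * (bform w h ^+ 2 * bform v v +
    2 * bform w h * - bform v h * bform v w + (- bform v h) ^+ 2 * bform w w) =
   (bform w h * bform v v - bform v h * bform v w) ^+ 2 +
   bform v h ^+ 2 * (bform v v * bform w w - bform v w ^+ 2) by ring.
have [->|vh] := eqVneq (bform v h) 0.
  by rewrite expr0n !mul0r subr0 addr0 exprMn mulr_gt0 // exprn_gt0.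
apply: ltr_wpDl; first exact: sqr_ge0.
by rewrite mulr_gt0 ?subr_gt0 // exprn_even_gt0.
Qed.

End BilinearForm.

(** * Lagrange multipliers on an ellipsoid in a hyperplane *)

Section ConstrainedMaximum.
Local Open Scope classical_set_scope.
Variables (R : realType) (I : finType) (M : I -> I -> R).
Hypothesis Msym : forall i j, M i j = M j i.
Variables (g c : I -> R).
Hypothesis g_gt0 : forall i, 0 < g i.

Let G (v : I -> R) := \sum_i g i * v i ^+ 2.
Let L (v : I -> R) := \sum_i c i * v i.


(** First-order condition at a minimum: for small [t] of sign opposite to [a] the linear term
    prevails. *)
Lemma quadratic_lin0 (a b : R) : (forall t, 0 <= t * a + t ^+ 2 * b) -> a = 0.
Proof.
move=> ge0; apply/eqP/negPn/negP => a_neq0.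
have b_gt0 : 0 < `|b| + 1 by rewrite ltr_wpDl.
pose t := - a / (2 * (`|b| + 1)).
have := ge0 t; rewrite leNgt => /negP; apply.
have -> : t * a + t ^+ 2 * b =
    a ^+ 2 / (2 * (`|b| + 1)) * (b / (2 * (`|b| + 1)) - 1).
  rewrite /t; field; lra.
rewrite pmulr_rlt0; last first.
  by apply: divr_gt0; [rewrite exprn_even_gt0|rewrite mulr_gt0 // ltr0Sn].
rewrite subr_lt0 ltr_pdivrMr ?mulr_gt0 //; have := ler_norm b.
lra.
Qed.

Let row_fun (x : 'rV[R]_#|I|) (i : I) : R := x ord0 (enum_rank i).

Let row_funK (v : I -> R) : row_fun (\row_k v (enum_val k)) = v.
Proof. by apply/funext => i; rewrite /row_fun mxE enum_rankK. Qed.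

Let row_fun_continuous i : continuous (row_fun ^~ i).
Proof. exact: coord_continuous. Qed.

Let continuousMf (f1 f2 : 'rV[R]_#|I| -> R) :
  continuous f1 -> continuous f2 -> continuous (fun x => f1 x * f2 x).
Proof. by move=> c1 c2 x; exact: cvgM (c1 x) (c2 x). Qed.

Let continuous_sum (F : I -> 'rV[R]_#|I| -> R) :
  (forall i, continuous (F i)) -> continuous (fun x => \sum_i F i x).
Proof. by move=> cF; apply: continuous_big => //; exact: add_continuous. Qed.

(** Lagrange's condition at a maximum of the form on the compact set [G v = 1], [L v = 0]. Testing
    only directions [w] with [L w = 0] avoids a multiplier for [L]; the vector [v0] makes the
    maximum [lam] positive. *)
Lemma constrained_max_eigen (v0 : I -> R) : L v0 = 0 -> 0 < bform M v0 v0 ->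
  exists v (lam : R), [/\ G v = 1, L v = 0, 0 < lam &
    forall w, L w = 0 -> bform M v w = lam * \sum_i g i * v i * w i].
Proof.
move=> Lv0 Bv0.
have G_ge0 v : 0 <= G v by apply: sumr_ge0 => i _; rewrite mulr_ge0 ?sqr_ge0 // ltW.
have GZ a v : G (fun i => a * v i) = a ^+ 2 * G v.
  by rewrite /G big_distrr /=; apply: eq_bigr => i _; rewrite exprMn; ring.
have LZ a v : L (fun i => a * v i) = a * L v.
  by rewrite /L big_distrr /=; apply: eq_bigr => i _; ring.
have LD v w : L (fun i => v i + w i) = L v + L w.
  by rewrite /L -big_split /=; apply: eq_bigr => i _; ring.
have G_eq0 v : G v = 0 -> v = fun=> 0.
  move=> /eqP; rewrite psumr_eq0 => [/allP z|i _]; last first.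
    by rewrite mulr_ge0 ?sqr_ge0 // ltW.
  apply/funext => i; have := z i (mem_index_enum i).
  by rewrite mulf_eq0 gt_eqF //= expf_eq0 /= => /eqP.
have B0 : bform M (fun=> 0) (fun=> 0) = 0.
  by rewrite /bform big1 // => i _; rewrite mul0r.
have Gv0 : 0 < G v0.
  rewrite lt_def G_ge0 andbT; apply/negP => /eqP/G_eq0 v00.
  by move: Bv0; rewrite v00 B0 ltxx.
pose A := [set x : 'rV[R]_#|I| | G (row_fun x) = 1 /\ L (row_fun x) = 0].
have normalize v : 0 < G v -> L v = 0 ->
    A (\row_k ((Num.sqrt (G v))^-1 * v (enum_val k))).
  move=> Gv Lv; rewrite /A /= -[X in G (row_fun X)]/(\row_k _).
  rewrite (row_funK (fun i => (Num.sqrt (G v))^-1 * v i)) GZ LZ Lv mulr0.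
  by split=> //; rewrite exprVn sqr_sqrtr ?mulVf ?gt_eqF // ltW.
have contG : continuous (fun x => G (row_fun x)).
  apply: continuous_sum => i; apply: continuousMf; first exact: cst_continuous.
  under eq_fun do rewrite expr2.
  by apply: continuousMf; exact: row_fun_continuous.
have contL : continuous (fun x => L (row_fun x)).
  apply: continuous_sum => i; apply: continuousMf (@row_fun_continuous i).
  exact: cst_continuous.
have contB : continuous (fun x => bform M (row_fun x) (row_fun x)).
  apply: continuous_sum => i; apply: continuousMf (@row_fun_continuous i) _.
  apply: continuous_sum => j; apply: continuousMf (@row_fun_continuous j).
  exact: cst_continuous.
(* The bound [1 + (g i)^-1] on a coordinate avoids a square root: its square exceeds [(g i)^-1],
   which bounds the square of the coordinate. *)
have cA : compact A.
  apply: (@subclosed_compact _ _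
    [set x : 'rV[R]_#|I| | forall k, `[- (1 + (g (enum_val k))^-1),
                                    1 + (g (enum_val k))^-1]%classic (x ord0 k)]).
  - rewrite (_ : A = (fun x => G (row_fun x)) @^-1` [set 1] `&`
                     (fun x => L (row_fun x)) @^-1` [set 0]) //.
    by apply: closedI; [move/continuous_closedP: contG | move/continuous_closedP: contL]; apply; exact: closed_eq.
  - apply: (@rV_compact _ _ (fun k => `[- (1 + (g (enum_val k))^-1),
                                    1 + (g (enum_val k))^-1]%classic)) => k.
    exact: segment_compact.
  - move=> x [Gx _] k /=; rewrite in_itv /= -ler_norml.
    set i := enum_val k; have gi := g_gt0 i.
    have -> : x ord0 k = row_fun x i by rewrite /row_fun /i enum_valK.
    have : g i * row_fun x i ^+ 2 <= 1.
      rewrite -Gx /G (bigD1 i) //= lerDl sumr_ge0 // => j _.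
      by rewrite mulr_ge0 ?sqr_ge0 // ltW.
    rewrite -ler_pdivlMl // mulr1 => le; rewrite -(ler_pXn2r (n := 2)) ?nnegrE //; last first.
      by rewrite addr_ge0 // invr_ge0 ltW.
    have gV : 0 < (g i)^-1 by rewrite invr_gt0.
    by rewrite -normrX ger0_norm ?sqr_ge0 //; nra.
have A0 : A !=set0 by exists (\row_k ((Num.sqrt (G v0))^-1 * v0 (enum_val k))); exact: normalize.
have [x /set_mem[Gx Lx] xmax] := EVT_max_rV A0 cA (continuous_subspaceT contB).
set v := row_fun x in Gx Lx xmax.
set lam := bform M v v in xmax.
have le_lam w : L w = 0 -> bform M w w <= lam * G w.
  move=> Lw; have := G_ge0 w; rewrite le_eqVlt => /orP[/eqP Gw|Gw].
    by rewrite -Gw mulr0 (G_eq0 w (esym Gw)) B0.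
  have /mem_set/xmax := normalize _ Gw Lw.
  rewrite (row_funK (fun i => (Num.sqrt (G w))^-1 * w i)).
  rewrite bformZl // bformZr mulrA -expr2 exprVn sqr_sqrtr ?(ltW Gw) //.
  by rewrite mulrC ler_pdivrMr.
exists v, lam; split=> //.
  by rewrite -(pmulr_lgt0 _ Gv0); exact: lt_le_trans Bv0 (le_lam _ Lv0).
move=> w Lw; apply/eqP; rewrite -subr_eq0; apply/eqP.
(* Along [v + t * w] the inequality [le_lam] is an equality at [t = 0], so its linear coefficient in
   [t] vanishes. *)
have H : 2 * (lam * (\sum_i g i * v i * w i) - bform M v w) = 0.
  apply: (@quadratic_lin0 _ (lam * G w - bform M w w)) => t.
  have : L (fun i => 1 * v i + t * w i) = 0 by rewrite LD !LZ Lx Lw !mulr0 addr0.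
  move/le_lam; rewrite bform_comb //.
  have -> : G (fun i => 1 * v i + t * w i) =
     G v + 2 * t * (\sum_i g i * v i * w i) + t ^+ 2 * G w.
    rewrite /G !big_distrr /= -!big_split /=; apply: eq_bigr => i _; ring.
  rewrite Gx -/lam; lra.
lra.
Qed.

End ConstrainedMaximum.

(** * From the links of a matrix to the matrix itself *)

Section LocalGlobal.
Variables (R : realType) (I : finType) (M : I -> I -> R) (h : I -> R).
Hypothesis Msym : forall i j, M i j = M j i.
Hypothesis M_ge0 : forall i j, 0 <= M i j.
Hypothesis h_gt0 : forall i, 0 < h i.

Let d i := mxact M h i.

Hypothesis local : forall v,
  bform M v v <= \sum_(i | 0 < d i) h i * mxact M v i ^+ 2 / d i.
Hypothesis connected : forall v : I -> R,
  (forall i j, 0 < M i j -> v i / h i = v j / h j) ->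
  forall i j, 0 < d i -> 0 < d j -> v i / h i = v j / h j.

Let d_ge0 i : 0 <= d i.
Proof. by apply: sumr_ge0 => j _; rewrite mulr_ge0 // ltW. Qed.

Let M_eq0 i j : ~~ (0 < d i) -> M i j = 0.
Proof.
rewrite lt_def d_ge0 andbT negbK /d /mxact psumr_eq0 => [|k _]; last first.
  by rewrite mulr_ge0 // ltW.
move=> /allP/(_ j (mem_index_enum j)).
by rewrite mulf_eq0 (gt_eqF (h_gt0 j)) orbF => /eqP.
Qed.

(** The diagonal metric in which [h] has eigenvalue 1: [mxact M h i = g i * h i] where [d i] is
    positive. The other rows of [M] vanish, and the value 1 keeps the metric positive definite
    there. *)
Let g i := if 0 < d i then d i / h i else 1.

Let g_gt0 i : 0 < g i.
Proof. by rewrite /g; case: ifP => // di; rewrite divr_gt0. Qed.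

Let mxact_eq0 v i : ~~ (0 < d i) -> mxact M v i = 0.
Proof. by move=> di; rewrite /mxact big1 // => j _; rewrite M_eq0 // mul0r. Qed.

(** The Dirichlet form of the graph with edge weights [M i j * h i * h j], taken at [v / h]. Being
    nonnegative, it bounds the form of [M] by the metric [g]; it vanishes only if [v / h] is
    constant along edges. *)
Let defect v : \sum_i \sum_j M i j * h i * h j * (v i / h i - v j / h j) ^+ 2 =
  2 * (\sum_i d i / h i * v i ^+ 2 - bform M v v).
Proof.
have E1 : \sum_i \sum_j M i j * h j / h i * v i ^+ 2 = \sum_i d i / h i * v i ^+ 2.
  apply: eq_bigr => i _; rewrite /d /mxact !big_distrl /=.
  by apply: eq_bigr => j _; ring.
have E2 : \sum_i \sum_j M i j * h i / h j * v j ^+ 2 = \sum_i d i / h i * v i ^+ 2.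
  by rewrite exchange_big /= -E1; apply: eq_bigr => i _; apply: eq_bigr => j _; rewrite Msym.
have E3 : bform M v v = \sum_i \sum_j M i j * v i * v j.
  apply: eq_bigr => i _; rewrite /mxact big_distrr /=.
  by apply: eq_bigr => j _; ring.
rewrite mulrBr mulr_natl mulr2n -[X in X + _ - _]E1 -[X in _ + X - _]E2 E3.
rewrite big_distrr /= -big_split -sumrB /=; apply: eq_bigr => i _.
rewrite big_distrr /= -big_split -sumrB /=; apply: eq_bigr => j _.
have := h_gt0 i; have := h_gt0 j => hj hi; field.
by rewrite !gt_eqF.
Qed.

Let defect_ge0 v i j : 0 <= M i j * h i * h j * (v i / h i - v j / h j) ^+ 2.
Proof. by rewrite mulr_ge0 ?sqr_ge0 // !mulr_ge0 // ltW. Qed.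

(* On the hyperplane, a maximizer of the form on the sphere of [g] is an eigenvector
   whose eigenvalue is at least 1 by [local] and at most 1 by [defect] (AM-GM); the
   equality case is excluded by [connected]. *)
Lemma neg_on_hyperplane v : bform M v h = 0 -> bform M v v <= 0.
Proof.
move=> vh; rewrite leNgt; apply/negP => v_gt0.
have Lh w : bform M w h = \sum_i d i * w i.
  by apply: eq_bigr => i _; rewrite mulrC.
rewrite Lh in vh.
have [u [lam [Gu Lu lam_gt0 eig]]] := constrained_max_eigen Msym g_gt0 vh v_gt0.
pose delta (k j : I) : R := (j == k)%:R.
have sum_delta (F : I -> R) k : \sum_i F i * delta k i = F k.
  rewrite (bigD1 k) //= /delta eqxx mulr1 big1 ?addr0 // => i /negbTE->.
  by rewrite mulr0.
have bform_delta k : bform M u (delta k) = mxact M u k.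
  by rewrite bformC // -[RHS]sum_delta; apply: eq_bigr => i _; rewrite mulrC.
have u_off i : ~~ (0 < d i) -> u i = 0.
  move=> di; have d0 : d i = 0 by move: di; rewrite lt_def d_ge0 andbT negbK => /eqP.
  have := eig (delta i); rewrite sum_delta d0 bform_delta mxact_eq0 // sum_delta.
  by move=> /(_ erefl)/esym/eqP; rewrite !mulf_eq0 (gt_eqF lam_gt0) (gt_eqF (g_gt0 i)) => /eqP.
have Lh_gt0 : 0 < \sum_i d i * h i.
  rewrite lt_def sumr_ge0 ?andbT => [|i _]; last by rewrite mulr_ge0 // ltW.
  rewrite psumr_eq0 => [|i _]; last by rewrite mulr_ge0 // ltW.
  apply/negP => /allP d0; move: v_gt0; rewrite /bform big1 ?ltxx // => i _.
  rewrite mxact_eq0 ?mulr0 // lt_def negb_and negbK.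
  by have := d0 i (mem_index_enum i); rewrite mulf_eq0 (gt_eqF (h_gt0 i)) orbF /= => ->.
have guh : \sum_i g i * u i * h i = 0.
  rewrite -[RHS]Lu; apply: eq_bigr => i _; rewrite /g; case: ifPn => di.
    by have hi := h_gt0 i; field; rewrite gt_eqF.
  by rewrite u_off // !mulr0 mul0r.
have uh : bform M u h = 0 by rewrite Lh.
(* The test vector is [delta k] projected along [h] onto the hyperplane. Both [bform M u h] and the
   [g]-product of [u] with [h] vanish, so the eigenvalue equation holds coordinate by coordinate. *)
have Mu k : mxact M u k = lam * (g k * u k).
  pose w j := delta k j + (- (d k / \sum_i d i * h i)) * h j.
  have E (F : I -> R) : \sum_i F i * w i =
      F k - d k / (\sum_i d i * h i) * \sum_i F i * h i.
    rewrite -sum_delta mulr_sumr -sumrB; apply: eq_bigr => i _; rewrite /w; ring.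
  have := eig w; rewrite !E mulfVK ?gt_eqF // subrr guh mulr0 subr0 => <- //.
  by rewrite /w bformDr bformZr uh mulr0 addr0 bform_delta.
have Buu : bform M u u = lam.
  by rewrite eig // -[RHS]mulr1 -[X in _ = _ * X]Gu; congr (_ * _); apply: eq_bigr => i _; rewrite expr2 mulrA.
have dGu : \sum_i d i / h i * u i ^+ 2 = 1.
  rewrite -[RHS]Gu; apply: eq_bigr => i _; rewrite /g; case: ifPn => // di.
  by rewrite u_off // expr0n !mulr0.
have lam_ge1 : 1 <= lam.
  have := local u; rewrite Buu.
  have -> : \sum_(i | 0 < d i) h i * mxact M u i ^+ 2 / d i = lam ^+ 2.
    rewrite -[RHS]mulr1 -[X in _ = _ * X]dGu mulr_sumr [RHS](bigID (fun i => 0 < d i)) /=.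
    rewrite [X in _ = _ + X]big1 ?addr0 => [|i di]; last by rewrite u_off // expr0n !mulr0.
    apply: eq_bigr => i di; rewrite Mu /g di; have hi := h_gt0 i.
    by field; rewrite !gt_eqF.
  by rewrite expr2 ler_pMr.
have dfct := defect u; rewrite dGu Buu in dfct.
have M_conn i j : 0 < M i j -> u i / h i = u j / h j.
  move=> Mij; apply/eqP; rewrite -subr_eq0 -sqrf_eq0.
  have : M i j * h i * h j * (u i / h i - u j / h j) ^+ 2 <= 0.
    have le0 : 2 * (1 - lam) <= 0 by lra.
    apply: le_trans le0; rewrite -dfct (bigD1 i) //= (bigD1 j) //= -!addrA lerDl.
    by rewrite addr_ge0 ?sumr_ge0 // => k _; rewrite sumr_ge0.
  rewrite pmulr_rle0; last by rewrite !mulr_gt0.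
  by rewrite eq_le sqr_ge0 => ->.
(* Hence [u] is a multiple of [h] where [d] is positive; being orthogonal to [h], it is zero,
   against [Gu]. *)
have u_prop := connected M_conn.
have [i0 d0|alld0] := pickP (fun i => 0 < d i); last first.
  by move: Lh_gt0; rewrite big1 ?ltxx // => i _; have := alld0 i; rewrite lt_def d_ge0 andbT => /negbFE/eqP->; rewrite mul0r.
have u_eq i : 0 < d i -> u i = u i0 / h i0 * h i.
  by move=> di; rewrite -(u_prop i i0) // mulfVK // gt_eqF.
have : \sum_i d i * u i = u i0 / h i0 * \sum_i d i * h i.
  rewrite mulr_sumr; apply: eq_bigr => i _; have [di|di] := boolP (0 < d i).
    by rewrite u_eq //; ring.
  by move: di; rewrite lt_def d_ge0 andbT negbK => /eqP->; rewrite !mul0r mulr0.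
rewrite Lu => /esym/eqP; rewrite mulf_eq0 (gt_eqF Lh_gt0) orbF => /eqP k0.
have : \sum_i g i * u i ^+ 2 = 0.
  rewrite big1 // => i _; have [di|di] := boolP (0 < d i).
    by rewrite u_eq // k0 mul0r expr0n mulr0.
  by rewrite u_off // expr0n mulr0.
by rewrite Gu => /eqP; rewrite oner_eq0.
Qed.

End LocalGlobal.

(** * Stanley's inequality *)

(** The Gram determinant of a form in two linear functionals [F] and [G] is [p * r - q ^+ 2] times a
    square. This serves the base case of the induction on the atlas. *)
Lemma hyperbolic_rank2 (R : realType) (I : finType) (M : I -> I -> R) (p q r : R)
    (f g : I -> R) : p * r <= q ^+ 2 ->
  (forall i j, M i j = p * f i * f j + q * (f i * g j + g i * f j) + r * g i * g j) ->
  forall v w, bform M v v * bform M w w <= bform M v w ^+ 2.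
Proof.
move=> pr ME v w; pose F (x : I -> R) := \sum_i f i * x i; pose G (x : I -> R) := \sum_i g i * x i.
have BE x y : bform M x y = p * F x * F y + q * (F x * G y + G x * F y) + r * G x * G y.
  have actE i : mxact M y i = (p * f i + q * g i) * F y + (q * f i + r * g i) * G y.
    rewrite /mxact /F /G !mulr_sumr -big_split /=; apply: eq_bigr => j _; rewrite ME; ring.
  rewrite /bform (eq_bigr (fun i => (p * F y + q * G y) * (f i * x i) +
     (q * F y + r * G y) * (g i * x i))) => [|i _]; last by rewrite actE; ring.
  by rewrite big_split -!mulr_sumr -/(F x) -/(G x) /=; ring.
rewrite !BE -subr_ge0.
set e := (X in 0 <= X).
have -> : e = (q ^+ 2 - p * r) * (F v * G w - G v * F w) ^+ 2 by rewrite /e; ring.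
by rewrite mulr_ge0 ?sqr_ge0 // subr_ge0.
Qed.

(** For positive terms log-concavity says that the ratios [f i.+1 / f i] do not increase; [k]
    comparisons of ratios are multiplied. Unlike the one-step inequality, this form excludes
    internal zeros even after a limit in which positivity is lost. *)
Lemma log_concave_ratio (R : realFieldType) (f : nat -> R) (n : nat) :
  (forall i, (i <= n)%N -> 0 < f i) ->
  (forall i, (i.+2 <= n)%N -> f i * f i.+2 <= f i.+1 ^+ 2) ->
  forall a b k, (a <= b)%N -> (b + k <= n)%N -> f a * f (b + k)%N <= f (a + k)%N * f b.
Proof.
move=> f_gt0 lc a b k ab bkn.
have step i j : (i <= j)%N -> (j.+1 <= n)%N -> f i * f j.+1 <= f i.+1 * f j.
  elim: j => [|j IH]; first by rewrite leqn0 => /eqP-> _; rewrite mulrC.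
  rewrite leq_eqVlt => /orP[/eqP->|]; first by rewrite mulrC.
  rewrite ltnS => ij jn; have {}IH := IH ij (ltnW jn).
  have fj : 0 < f j by apply: f_gt0; lia.
  have fj1 : 0 < f j.+1 by apply: f_gt0; lia.
  have fj2 : 0 < f j.+2 by apply: f_gt0; lia.
  have := lc j jn; rewrite -(ler_pM2l (f_gt0 i _)); last lia.
  move=> lcj; rewrite -(ler_pM2l fj).
  apply: le_trans (_ : f i * f j.+1 ^+ 2 <= _); first by rewrite mulrCA.
  by rewrite expr2 mulrA [leRHS]mulrA [f j * _]mulrC ler_pM2r.
elim: k bkn => [|k IH]; first by rewrite !addn0.
rewrite !addnS => bkn; have {}IH := IH (ltnW bkn).
have fbk : 0 < f (b + k)%N by apply: f_gt0; lia.
have fak : 0 < f (a + k)%N by apply: f_gt0; lia.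
have st := step (a + k)%N (b + k)%N (leq_add ab (leqnn k)) bkn.
have fbk1 : 0 < f (b + k).+1 by apply: f_gt0; lia.
have fb : 0 < f b by apply: f_gt0; lia.
rewrite -(ler_pM2r fak) -(ler_pM2r fbk).
have -> : f a * f (b + k).+1 * f (a + k)%N * f (b + k)%N =
   (f a * f (b + k)%N) * (f (a + k)%N * f (b + k).+1) by ring.
have -> : f (a + k).+1 * f b * f (a + k)%N * f (b + k)%N =
   (f (a + k)%N * f b) * (f (a + k).+1 * f (b + k)%N) by ring.
have fa : 0 < f a by apply: f_gt0; lia.
by apply: ler_pM => //; rewrite mulr_ge0 // ltW.
Qed.

(** Among the elements of [C] below [y], one with the fewest elements below it is minimal. *)
Lemma ex_minimal (T : finType) (lex : rel T) (C : {set T}) y :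
  reflexive lex -> antisymmetric lex -> transitive lex -> y \in C ->
  exists m, [/\ m \in C, lex m y & forall c, c \in C -> lex c m -> c = m].
Proof.
move=> lexx lex_anti lex_tr yC; pose below c := #|[set e | lex e c]|.
have y_cand : (y \in C) && lex y y by rewrite yC lexx.
case: (arg_minnP (P := fun c => (c \in C) && lex c y) below y_cand) => m /andP[mC my] mmin.
exists m; split=> // c cC cm; apply/eqP/negPn/negP => ncm.
have := mmin c; rewrite cC (lex_tr _ _ _ cm my) => /(_ isT).
rewrite leqNgt => /negP; apply; apply: proper_card; apply/properP; split.
  by apply/subsetP => e; rewrite !inE => ec; exact: lex_tr ec cm.
exists m; rewrite !inE ?lexx //; apply: contraNN ncm => mc.
by apply/eqP/lex_anti; rewrite cm.
Qed.

(** * The atlas of removals from the two ends of a poset *)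

Section Atlas.
Variables (R : realType) (T : finType) (le : rel T) (z : T).
Hypotheses (lex_refl : reflexive le) (lex_anti : antisymmetric le)
  (lex_trans : transitive le).

Implicit Types (Q : {set T}) (u y t p : bool * T) (l : seq (bool -> R)).

Definition dir_le (b : bool) (c e : T) := if b then le c e else le e c.

(* [(true, y)] removes [y] from the bottom of [Q], [(false, y)] from the top; [z] stays. *)
Definition removable (Q : {set T}) (p : bool * T) :=
  [&& p.2 \in Q, p.2 != z & [forall v in Q, dir_le p.1 v p.2 ==> (v == p.2)]].

(** A multilinear form in the weights, symmetric by [removalsC]. If [Q] has n + 1 elements, its
    value at n equal weights [h] is n! times the volume of the order-preserving maps from [Q] to
    [- h true, h false] that send [z] to 0. *)
Fixpoint removals (Q : {set T}) (l : seq (bool -> R)) : R :=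
  if l is h :: l' then \sum_(y | removable Q y) h y.1 * removals (Q :\ y.2) l' else 1.

(* The label of [u] passes to the elements which the removal of [u] makes removable. *)
Definition origin (Q : {set T}) (u y : bool * T) :=
  if (y.1 == u.1) && ~~ removable Q y then u else y.

(* Mixed second derivatives of the volume of the order polytope, in the directions
   of the facets given by its minimal and maximal elements. *)
Definition atlas_mx (Q : {set T}) l (u v : bool * T) : R :=
  if removable Q u then
    \sum_(y | removable (Q :\ u.2) y && (origin Q u y == v)) removals (Q :\ u.2 :\ y.2) l
  else 0.

Definition removals_lin (Q : {set T}) l (w : bool * T -> R) : R :=
  \sum_(y | removable Q y) w y * removals (Q :\ y.2) l.

Lemma origin1 Q u y : (origin Q u y).1 = y.1.
Proof. by rewrite /origin; case: eqP => //= yu; case: ifP. Qed.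

Lemma origin_removable Q u y : removable Q y -> origin Q u y = y.
Proof. by rewrite /origin => ->; rewrite andbF. Qed.

Lemma removableP (Q : {set T}) p : reflect [/\ p.2 \in Q, p.2 != z &
  forall v, v \in Q -> dir_le p.1 v p.2 -> v = p.2] (removable Q p).
Proof.
apply: (iffP and3P) => -[pQ pz ext]; split=> //.
  by move=> v vQ vp; move/forall_inP: ext => /(_ v vQ)/implyP/(_ vp)/eqP.
by apply/forall_inP => v vQ; apply/implyP => vp; apply/eqP/ext.
Qed.

Lemma removable_setD1 Q u y : removable Q y -> u.2 != y.2 -> removable (Q :\ u.2) y.
Proof.
move=> /removableP[yQ yz ext] uy; apply/removableP; split=> //.
  by rewrite !inE eq_sym uy.
by move=> v /setD1P[_ vQ]; exact: ext.
Qed.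

Lemma removable_new Q u y : removable (Q :\ u.2) y -> ~~ removable Q y -> dir_le y.1 u.2 y.2 /\ u.2 != y.2.
Proof.
move=> /removableP[/setD1P[yu yQ] yz ext] /removableP nav; rewrite eq_sym yu; split=> //.
apply/negPn/negP => nuy; apply: nav; split=> // v vQ vy.
have [vu|vu] := eqVneq v u.2; first by rewrite -vu vy in nuy.
by apply: ext => //; rewrite !inE vu.
Qed.

(** If [u] left at the bottom and thereby freed [y] at the top, then [u] would lie above [y],
    against the minimality of [u]; likewise with the ends exchanged. *)
Lemma removable_new1 Q u y : removable Q u -> removable (Q :\ u.2) y -> ~~ removable Q y -> y.1 = u.1.
Proof.
move=> /removableP[uQ uz ext] avy nav; have [uy] := removable_new avy nav.
have /removableP[/setD1P[_ yQ] _ _] := avy.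
apply: contraNeq => y1; rewrite (ext y.2) //.
by move: uy y1; rewrite /dir_le; case: y.1; case: u.1.
Qed.

Lemma origin_new Q u y : removable Q u -> removable (Q :\ u.2) y -> ~~ removable Q y -> origin Q u y = u.
Proof. by move=> avu avy nav; rewrite /origin (removable_new1 avu avy nav) eqxx nav. Qed.

Lemma removable_old Q u y : removable (Q :\ u.2) y && removable Q y = removable Q y && (u.2 != y.2).
Proof.
apply/andP/andP => [[/removableP[/setD1P[]]]|[avy uy]]; first by rewrite eq_sym.
by split=> //; exact: removable_setD1.
Qed.

(** The first sum runs over pairs removable in either order, hence is symmetric. In the second, [u]
    frees [y], so both are removed at the same end and their weights can be exchanged. *)
Lemma pair_sum Q (G : bool * T -> bool * T -> R) :
  \sum_(u | removable Q u) \sum_(y | removable (Q :\ u.2) y) G u y =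
  \sum_(u | removable Q u) \sum_(y | removable Q y && (u.2 != y.2)) G u y +
  \sum_(u | removable Q u) \sum_(y | removable (Q :\ u.2) y && ~~ removable Q y) G u y.
Proof.
rewrite -big_split /=; apply: eq_bigr => u avu.
rewrite (bigID (removable Q)) /=; congr (_ + _); apply: eq_bigl => y; exact: removable_old.
Qed.

Lemma old_sum_swap Q (G : bool * T -> bool * T -> R) :
  \sum_(u | removable Q u) \sum_(y | removable Q y && (u.2 != y.2)) G u y =
  \sum_(u | removable Q u) \sum_(y | removable Q y && (u.2 != y.2)) G y u.
Proof.
rewrite (exchange_big_dep (removable Q)) => [|u y _ /andP[]//] /=.
apply: eq_bigr => y avy; apply: eq_bigl => u.
by rewrite avy /= eq_sym.
Qed.

Lemma setD1C (Q : {set T}) a b : Q :\ a :\ b = Q :\ b :\ a.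
Proof. by rewrite !setDDl setUC. Qed.

Lemma removalsC Q h h' l : removals Q (h :: h' :: l) = removals Q (h' :: h :: l).
Proof.
rewrite /=; under eq_bigr do rewrite mulr_sumr.
under [RHS]eq_bigr do rewrite mulr_sumr.
rewrite !pair_sum; congr (_ + _).
  rewrite old_sum_swap; apply: eq_bigr => u _; apply: eq_bigr => y _.
  by rewrite setD1C; ring.
apply: eq_bigr => u avu; apply: eq_bigr => y /andP[avy nav].
by rewrite (removable_new1 avu avy nav); ring.
Qed.

Lemma removals_catC Q l1 h h' l : removals Q (l1 ++ h :: h' :: l) = removals Q (l1 ++ h' :: h :: l).
Proof.
elim: l1 Q => [|k l1 IH] Q; first exact: removalsC.
by rewrite /=; apply: eq_bigr => y _; rewrite IH.
Qed.

(** Only pairs removable in either order contribute off the diagonal: [origin] moves every pair in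
    which [u] frees [y] to the diagonal entry of [u]. *)
Lemma atlas_mx_neq Q l u (v : bool * T) : u != v ->
  atlas_mx Q l u v = if [&& removable Q u, removable Q v & u.2 != v.2] then removals (Q :\ u.2 :\ v.2) l else 0.
Proof.
move=> uv; rewrite /atlas_mx; case: ifPn => //= avu; case: ifPn => [/andP[avv uv2]|nav].
  rewrite (bigD1 v) /=; last by rewrite origin_removable // eqxx removable_setD1.
  rewrite big1 ?addr0 // => y /andP[/andP[avy /eqP laby] yv].
  have [oldy|newy] := boolP (removable Q y).
    by move: laby yv; rewrite origin_removable // => ->; rewrite eqxx.
  by move: laby uv; rewrite origin_new // => ->; rewrite eqxx.
rewrite big1 // => y /andP[avy /eqP laby].
have [oldy|newy] := boolP (removable Q y); last first.
  by move: laby uv; rewrite origin_new // => ->; rewrite eqxx.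
move: laby nav; rewrite origin_removable // => <-.
by have := removable_old Q u y; rewrite avy oldy /= => <-.
Qed.

Lemma atlas_mx_sym Q l u (v : bool * T) : atlas_mx Q l u v = atlas_mx Q l v u.
Proof.
have [->//|uv] := eqVneq u v.
rewrite !atlas_mx_neq //; last by rewrite eq_sym.
by rewrite setD1C andbCA [u.2 == _]eq_sym.
Qed.

Lemma mxact_atlas_mx Q l w u :
  mxact (atlas_mx Q l) w u = if removable Q u then removals_lin (Q :\ u.2) l (w \o origin Q u) else 0.
Proof.
rewrite /mxact /atlas_mx; case: ifPn => avu; last by rewrite big1 // => v _; rewrite mul0r.
rewrite /removals_lin [RHS](partition_big (origin Q u) predT) //=.
apply: eq_bigr => v _; rewrite mulr_suml; apply: eq_bigr => y /andP[_ /eqP<-].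
by rewrite mulrC.
Qed.

Lemma bform_atlas_mx Q l v w : bform (atlas_mx Q l) v w =
  \sum_(u | removable Q u) v u * removals_lin (Q :\ u.2) l (w \o origin Q u).
Proof.
rewrite /bform [RHS]big_mkcond /=; apply: eq_bigr => u _.
by rewrite mxact_atlas_mx; case: ifP; rewrite ?mulr0.
Qed.

(** Contracting the matrix with [h] restores one removal of weight [h], because [origin] preserves
    the direction. *)
Lemma removals_lin_cons Q h l w : removals_lin Q (h :: l) w = bform (atlas_mx Q l) w (h \o fst).
Proof.
rewrite bform_atlas_mx; apply: eq_bigr => u avu; congr (_ * _).
by apply: eq_bigr => y _; rewrite /= origin1.
Qed.

Lemma mxact_atlas_mx_cons Q h l w u : removable Q u ->
  mxact (atlas_mx Q (h :: l)) w u = bform (atlas_mx (Q :\ u.2) l) (w \o origin Q u) (h \o fst).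
Proof. by move=> avu; rewrite mxact_atlas_mx avu removals_lin_cons. Qed.

Lemma removals_ge0 Q l : (forall h, List.In h l -> forall b, 0 < h b) -> 0 <= removals Q l.
Proof.
elim: l Q => [|h l IH] Q //= hl; apply: sumr_ge0 => y _.
rewrite mulr_ge0 //; first by rewrite ltW // hl //; left.
by apply: IH => k kl; apply: hl; right.
Qed.

(* Only an element freed by [u] and [y] together remembers their order. *)
Lemma origin_swap Q u y t : removable Q u -> removable Q y -> u.2 != y.2 -> removable (Q :\ u.2 :\ y.2) t ->
  origin Q u (origin (Q :\ u.2) y t) != origin Q y (origin (Q :\ y.2) u t) ->
  [/\ origin Q u (origin (Q :\ u.2) y t) = y, origin Q y (origin (Q :\ y.2) u t) = u & u.1 = y.1].
Proof.
move=> avu avy uy avt.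
have avt' : removable (Q :\ y.2 :\ u.2) t by rewrite setD1C.
have avu' : removable (Q :\ y.2) u by rewrite removable_setD1 // eq_sym.
have avy' : removable (Q :\ u.2) y by rewrite removable_setD1.
have [avQt|navQt] := boolP (removable Q t).
  have /removableP[/setD1P[ty /setD1P[tu _]] _ _] := avt.
  by rewrite !(@origin_removable _ _ t) ?eqxx // removable_setD1 // eq_sym.
have [avut|navut] := boolP (removable (Q :\ u.2) t); have [avyt|navyt] := boolP (removable (Q :\ y.2) t).
- have [tu _] := removable_new avut navQt; have /removableP[_ _ ext] := avyt.
  have /removableP[/setD1P[tu' _] _ _] := avut.
  move: tu'; rewrite -(ext u.2) ?eqxx // !inE uy.
  by have /removableP[] := avu.
- by rewrite (origin_removable _ avut) (origin_new avu avut navQt) (origin_new avu' avt' navyt) origin_removable // eqxx.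
- by rewrite (origin_removable _ avyt) (origin_new avy avyt navQt) (origin_new avy' avt navut) origin_removable // eqxx.
rewrite (origin_new avu' avt' navyt) (origin_new avy' avt navut) !origin_removable //; split=> //.
by rewrite -(removable_new1 avu' avt' navyt) (removable_new1 avy' avt navut).
Qed.

(* Exchanging consecutive removals leaves only terms [(v y - v u) ^+ 2], see [origin_swap]. *)
Lemma atlas_pull Q h l v : (forall b, 0 < h b) ->
  (forall h, List.In h l -> forall b, 0 < h b) ->
  bform (atlas_mx Q (h :: l)) v v <=
  \sum_(u | removable Q u) h u.1 * bform (atlas_mx (Q :\ u.2) l) (v \o origin Q u) (v \o origin Q u).
Proof.
move=> h_gt0 l_gt0; rewrite bform_atlas_mx.
pose X u y := removals_lin (Q :\ u.2 :\ y.2) l (v \o origin Q u \o origin (Q :\ u.2) y).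
under eq_bigr do rewrite removals_lin_cons (bformC (atlas_mx_sym _ _)) bform_atlas_mx mulr_sumr.
under [leRHS]eq_bigr do rewrite bform_atlas_mx mulr_sumr.
rewrite !pair_sum; apply: lerD; last first.
  apply: ler_sum => u avu; apply: ler_sum => y /andP[avy nav] /=.
  rewrite (origin_new avu avy nav) (removable_new1 avu avy nav).
  by rewrite le_eqVlt; apply/orP; left; apply/eqP; ring.
rewrite -subr_ge0 -sumrB; under eq_bigr do rewrite -sumrB.
set S := (X in 0 <= X).
pose Y u y := (h u.1 * v y - v u * h y.1) * X u y.
have SE : S = \sum_(u | removable Q u) \sum_(y | removable Q y && (u.2 != y.2)) Y u y.
  apply: eq_bigr => u avu; apply: eq_bigr => y /andP[avy uy] /=.
  by rewrite /Y (origin_removable _ avy) /X; ring.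
suff : 0 <= S + S by lra.
rewrite {1}SE old_sum_swap SE -big_split /=; apply: sumr_ge0 => u avu.
rewrite -big_split /=; apply: sumr_ge0 => y /andP[avy uy].
have -> : Y y u + Y u y = (h u.1 * v y - v u * h y.1) * (X u y - X y u).
  by rewrite /Y; ring.
rewrite /X (setD1C Q y.2) -sumrB mulr_sumr; apply: sumr_ge0 => t avt /=.
rewrite -mulrBl mulrA mulr_ge0 ?removals_ge0 //.
have [->|neq] := eqVneq (origin Q u (origin (Q :\ u.2) y t)) (origin Q y (origin (Q :\ y.2) u t)).
  by rewrite subrr mulr0.
have [-> -> ->] := origin_swap avu avy uy avt neq.
have -> : (h y.1 * v y - v u * h y.1) * (v y - v u) = h y.1 * (v y - v u) ^+ 2 by ring.
by rewrite mulr_ge0 ?sqr_ge0 // ltW.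
Qed.

Lemma dir_le_trans b : transitive (dir_le b).
Proof.
by rewrite /dir_le; case: b => [|c e f ce /lex_trans]; [exact: lex_trans|exact].
Qed.

Lemma dir_le_refl b : reflexive (dir_le b).
Proof. by case: b => c; rewrite /dir_le. Qed.

Lemma dir_le_anti b : antisymmetric (dir_le b).
Proof. by case: b => c e; rewrite /dir_le => /andP[? ?]; apply: lex_anti; apply/andP. Qed.

Lemma ex_removable Q (y : T) : y \in Q -> y != z -> z \in Q -> exists p, removable Q p.
Proof.
move=> yQ yz zQ.
(* If [y] is above [z], go up to a maximal element, otherwise down to a minimal one; neither way can
   end at [z]. *)
pose b := ~~ le z y.
have [m [mQ my mmin]] := ex_minimal (dir_le_refl b) (@dir_le_anti b) (@dir_le_trans b) yQ.
exists (b, m); apply/removableP; split=> //=.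
apply/eqP => mz; move: my; rewrite mz /dir_le /b.
case: (boolP (le z y)) => //= zy yz'.
by move/eqP: yz; apply; apply: lex_anti; rewrite zy yz'.
Qed.

Definition all_pos l := forall h, List.In h l -> forall b, 0 < h b.

Lemma all_pos_cons h l : all_pos (h :: l) -> (forall b, 0 < h b) /\ all_pos l.
Proof. by move=> pos; split=> [b|k kl]; apply: pos; [left|right]. Qed.

Lemma removable_in Q p : removable Q p -> p.2 \in Q.
Proof. by case/removableP. Qed.

Lemma removable_neqz Q p : removable Q p -> p.2 != z.
Proof. by case/removableP. Qed.

Lemma removable_card Q p n : removable Q p -> #|Q| = n.+1 -> #|Q :\ p.2| = n.
Proof. by move=> /removable_in pQ; rewrite (cardsD1 p.2) pQ add1n => -[]. Qed.

Lemma removable_z Q p : removable Q p -> z \in Q -> z \in Q :\ p.2.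
Proof. by move=> /removable_neqz pz zQ; rewrite !inE eq_sym pz. Qed.

Lemma removals_gt0 Q l : all_pos l -> z \in Q -> #|Q| = (size l).+1 -> 0 < removals Q l.
Proof.
elim: l Q => [|h l IH] Q //= /all_pos_cons[h_gt0 l_gt0] zQ cQ.
have [y yQ yz] : exists2 y : T, y \in Q & y != z.
  have : (0 < #|Q :\ z|)%N by move: cQ; rewrite (cardsD1 z) zQ add1n => -[->].
  by case/card_gt0P => y /setD1P[yz yQ]; exists y.
have [p avp] := ex_removable yQ yz zQ.
rewrite (bigD1 p) //= ltr_wpDr //; last first.
  by rewrite mulr_gt0 // IH ?removable_z // (removable_card avp cQ).
apply: sumr_ge0 => y' _; rewrite mulr_ge0 ?removals_ge0 //; exact: ltW.
Qed.

Lemma bform_atlas_mx_hh Q h h' l :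
  bform (atlas_mx Q l) (h \o fst) (h' \o fst) = removals Q (h :: h' :: l).
Proof. by rewrite -removals_lin_cons. Qed.

Lemma atlas_mx_ge0 Q l u (v : bool * T) : all_pos l -> 0 <= atlas_mx Q l u v.
Proof.
move=> l_gt0; rewrite /atlas_mx; case: ifP => // _.
by apply: sumr_ge0 => y _; exact: removals_ge0.
Qed.

(** Removable labels of distinct elements are adjacent, so the only doubtful pair is formed by the
    two labels of one element. If both are removable, removing that element frees nothing, and its
    nonzero row yields a label of another element, adjacent to both. *)
Lemma atlas_mx_connected Q h l (v : bool * T -> R) : (forall b, 0 < h b) -> all_pos l ->
  z \in Q -> #|Q| = (size l).+3 ->
  (forall i j, 0 < atlas_mx Q l i j -> v i / h i.1 = v j / h j.1) ->
  forall i j, 0 < mxact (atlas_mx Q l) (h \o fst) i ->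
    0 < mxact (atlas_mx Q l) (h \o fst) j -> v i / h i.1 = v j / h j.1.
Proof.
move=> h_gt0 l_gt0 zQ cQ conn i j di dj.
have avd k : 0 < mxact (atlas_mx Q l) (h \o fst) k -> removable Q k.
  by rewrite mxact_atlas_mx; case: ifP => //; rewrite ltxx.
have [avi avj] := (avd _ di, avd _ dj).
have atlas_mx_gt0 u y : removable Q u -> removable Q y -> u.2 != y.2 -> 0 < atlas_mx Q l u y.
  move=> avu avy uy; rewrite atlas_mx_neq ?avu ?avy ?uy /=; last first.
    by apply: contraNneq uy => ->.
  have avy' := removable_setD1 avy uy.
  by rewrite removals_gt0 ?removable_z // (removable_card avy' (removable_card avu cQ)).
have [->//|ij] := eqVneq i j.
have [ij2|ij2] := eqVneq i.2 j.2; last by apply: conn; exact: atlas_mx_gt0.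
have [k avk ik] : exists2 k, removable Q k & i.2 != k.2.
  case: (pickP (fun k => atlas_mx Q l i k != 0)) => [k|all0]; last first.
    move: di; rewrite /mxact big1 ?ltxx // => k _.
    by move/negbFE/eqP: (all0 k) => ->; rewrite mul0r.
  have [<-|ik] := eqVneq i k; last first.
    by rewrite atlas_mx_neq //; case: ifP => [/and3P[_ avk ik2] _|]; [exists k|rewrite eqxx].
  rewrite /atlas_mx avi => nz.
  case: (pickP (fun y => removable (Q :\ i.2) y && (origin Q i y == i))) => [y /andP[avy /eqP laby]|none]; last first.
    by move: nz; rewrite big_pred0 ?eqxx.
  have [oldy|newy] := boolP (removable Q y).
    by have := removable_old Q i y; rewrite avy oldy => /esym/andP[_ iy]; exists y.
  have [iy iy2] := removable_new avy newy; have y1 := removable_new1 avi avy newy.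
  have /removableP[_ _ ext] := avj; have /removableP[/setD1P[_ yQ] _ _] := avy.
  have j1 : j.1 = ~~ i.1.
    move: ij ij2; rewrite -pair_eqE /pair_eq /= => + E; rewrite E eqxx andbT.
    by case: i.1; case: j.1.
  move: iy2; rewrite ij2 -(ext y.2 yQ) ?eqxx //.
  by move: iy; rewrite /dir_le y1 j1 ij2; case: i.1.
by rewrite (conn i k) ?atlas_mx_gt0 // -(conn j k) // atlas_mx_gt0 -?ij2.
Qed.

Definition hyperbolic_atlas_mx Q l := forall v w, 0 <= bform (atlas_mx Q l) w w ->
  bform (atlas_mx Q l) v v * bform (atlas_mx Q l) w w <= bform (atlas_mx Q l) v w ^+ 2.

(** By [atlas_pull] the form is at most a weighted sum of link forms. In the link at [u], the
    products of [v] with [h] and of [h] with [h] are the [u]-th coordinates of the matrix applied to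
    [v] and to [h], so hyperbolicity of the links is what [neg_on_hyperplane] asks for. *)
Lemma hyperbolic_atlas_mx_cons Q h l : all_pos (h :: l) -> z \in Q -> #|Q| = (size l).+4 ->
  (forall u, removable Q u -> hyperbolic_atlas_mx (Q :\ u.2) l) -> hyperbolic_atlas_mx Q (h :: l).
Proof.
move=> /[dup] hl_gt0 /all_pos_cons[h_gt0 l_gt0] zQ cQ IH.
apply: (@hyperbolic_of_hyperplane _ _ _ (atlas_mx_sym Q (h :: l)) (h \o fst)).
apply: neg_on_hyperplane.
- exact: atlas_mx_sym.
- by move=> i j; exact: atlas_mx_ge0.
- by move=> i /=.
- move=> v; apply: (le_trans (atlas_pull Q v h_gt0 l_gt0)).
  have dE u : removable Q u -> mxact (atlas_mx Q (h :: l)) (h \o fst) u = removals (Q :\ u.2) (h :: h :: l).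
    move=> avu; rewrite mxact_atlas_mx_cons // -bform_atlas_mx_hh; congr (bform _ _ _).
    by apply/funext => y /=; rewrite origin1.
  have d_gt0 u : removable Q u -> 0 < mxact (atlas_mx Q (h :: l)) (h \o fst) u.
    move=> avu; rewrite dE // removals_gt0 ?removable_z // ?(removable_card avu cQ) //.
    by move=> k [<-|]; [exact: h_gt0|exact: hl_gt0].
  rewrite [leRHS](bigID (removable Q)) /= [X in _ <= _ + X]big1 ?addr0; last first.
    by move=> u /andP[_ nav]; rewrite mxact_atlas_mx (negbTE nav) expr0n /= mulr0 mul0r.
  under [leRHS]eq_bigl => u do rewrite (andb_idl (d_gt0 u)).
  apply: ler_sum => u avu; rewrite -mulrA ler_pM2l // ler_pdivlMr ?d_gt0 //.
  rewrite dE // mxact_atlas_mx_cons // -bform_atlas_mx_hh; apply: IH => //.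
  rewrite bform_atlas_mx_hh removals_ge0 // => k; by case=> [<-//|]; exact: hl_gt0.
- by move=> v; exact: (atlas_mx_connected (l := h :: l)).
Qed.

Lemma removable_blocked Q p c : c \in Q -> dir_le p.1 c p.2 -> c != p.2 -> ~~ removable Q p.
Proof. by move=> cQ cp; apply: contraNN => /removableP[_ _ ext]; rewrite (ext c). Qed.

Lemma atlas_mx_diag Q u : removable Q u ->
  atlas_mx Q [::] u u = \sum_(y | removable (Q :\ u.2) y && ~~ removable Q y) 1.
Proof.
move=> avu; rewrite /atlas_mx avu /=; apply: eq_bigl => y.
have [avy|//] := boolP (removable (Q :\ u.2) y); have [oldy|newy] := boolP (removable Q y).
  rewrite /= origin_removable //; apply: contraTF avy => /eqP->.
  by apply/negP => /removable_in; rewrite !inE eqxx.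
by rewrite origin_new ?eqxx.
Qed.

Lemma hyperbolic_atlas_mx_nil Q : z \in Q -> #|Q| = 3 -> hyperbolic_atlas_mx Q [::].
Proof.
move=> zQ cQ v w _.
have [a [b [abz QE]]] : exists a b, uniq [:: z; a; b] /\ Q = [set z; a; b].
  have : #|Q :\ z| = 2 by move: cQ; rewrite (cardsD1 z) zQ => -[].
  move/eqP/cards2P => [a [b [ab QE]]]; exists a, b; split.
    have : z \notin Q :\ z by rewrite !inE eqxx.
    by rewrite QE !inE /= !inE ab => /negbTE->.
  by apply/setP => c; rewrite -(setD1K zQ) QE !inE orbA.
have {}abz : [/\ z != a, z != b & a != b].
  by move: abz; rewrite /= !inE negb_or andbT => /andP[/andP[-> ->] ->].
have [za zb ab] := abz.
have inQ c : c \in Q -> c != z -> c = a \/ c = b.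
  by rewrite QE !inE -orbA => /or3P[]/eqP->; [rewrite eqxx|left|right].
have aQ : a \in Q by rewrite QE !inE eqxx orbT.
have bQ : b \in Q by rewrite QE !inE eqxx !orbT.
wlog : a b za zb ab inQ aQ bQ {abz QE} / ~~ le b a.
  move=> wl; case: (boolP (le b a)) => [ba|]; last exact: wl.
  apply: (wl b a) => //; first by rewrite eq_sym.
    by move=> c cQ' cz; case: (inQ c cQ' cz); [right|left].
  by apply: contraNN ab => ab'; apply/eqP/lex_anti/andP.
move=> nba; have ba : b != a by rewrite eq_sym.
(* If [a] is below [b], at most the labels [i1] and [i2] are removable. Removing one element frees
   at most the other, so diagonal entries are at most 1, and the discriminant has the right sign. *)
have [leab|nab] := boolP (le a b).
  pose i1 := (true, a); pose i2 := (false, b).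
  have avE p : removable Q p -> p = i1 \/ p = i2.
    move=> avp; case: (inQ _ (removable_in avp) (removable_neqz avp)) => pE; move: avp; case: p pE => -[] c /= ->.
    - by left.
    - by rewrite (negbTE (@removable_blocked Q (false, a) b bQ leab _)) // eq_sym.
    - by rewrite (negbTE (@removable_blocked Q (true, b) a aQ leab ab)).
    - by right.
  have diag1 u : atlas_mx Q [::] u u <= 1.
    have [avu|nav] := boolP (removable Q u); last by rewrite /atlas_mx (negbTE nav).
    rewrite atlas_mx_diag //; pose c := if u.2 == a then b else a.
    rewrite (eq_bigl (fun y => (y == (u.1, c)) && (removable (Q :\ u.2) y && ~~ removable Q y))).
      rewrite big_mkcondr /= big_pred1_eq; case: ifP => //.
    move=> y; apply/esym/andb_idl => /andP[avy nav].
    have y1 := removable_new1 avu avy nav; have /removableP[/setD1P[yu yQ] yz _] := avy.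
    rewrite -pair_eqE /pair_eq /= y1 eqxx /= /c.
    case: (inQ _ yQ yz) yu => ->; case: (inQ _ (removable_in avu) (removable_neqz avu)) => ->;
      by rewrite ?eqxx ?(negbTE ba) ?eqxx.
  have diag0 u : 0 <= atlas_mx Q [::] u u by apply: atlas_mx_ge0.
  apply: (@hyperbolic_rank2 _ _ _ (atlas_mx Q [::] i1 i1) 1 (atlas_mx Q [::] i2 i2)
    (fun u => (removable Q u && (u == i1))%:R) (fun u => (removable Q u && (u == i2))%:R)).
    by rewrite expr1n mulr_ile1.
  move=> u y; have [->|uy] := eqVneq u y.
    have [avy|nav] := boolP (removable Q y); last by rewrite /atlas_mx (negbTE nav) /= !(mulr0, mul0r, addr0).
    by case: (avE y avy) => ->; rewrite eqxx /=; ring.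
  rewrite atlas_mx_neq //.
  have [avu|nav] := boolP (removable Q u); last by rewrite /=; ring.
  have [avy|nav] := boolP (removable Q y); last by rewrite /=; ring.
  case: (avE u avu) uy => ->; case: (avE y avy) => ->; rewrite ?eqxx //= ?ab ?ba ?eqxx /= => _; ring.
(* If [a] and [b] are incomparable, neither frees the other: the diagonal vanishes, and an entry
   between removable labels depends only on their elements. *)
apply: (@hyperbolic_rank2 _ _ _ 0 1 0
    (fun u => (removable Q u && (u.2 == a))%:R) (fun u => (removable Q u && (u.2 == b))%:R)).
  by rewrite mul0r sqr_ge0.
move=> u y; have [->|uy] := eqVneq u y.
  have [avy|nav] := boolP (removable Q y); last by rewrite /atlas_mx (negbTE nav) /= !(mulr0, mul0r, addr0).
  rewrite atlas_mx_diag // big_pred0 => [|t].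
    by case: (inQ _ (removable_in avy) (removable_neqz avy)) => ->; rewrite eqxx ?(negbTE ab) ?(negbTE ba) /=; ring.
  apply/negP => /andP[avt nav]; have [] := removable_new avt nav.
  have /removableP[/setD1P[_ tQ] tz _] := avt.
  case: (inQ _ tQ tz) => ->; case: (inQ _ (removable_in avy) (removable_neqz avy)) => ->; rewrite ?eqxx // /dir_le;
   by case: t.1; rewrite ?(negbTE nab) ?(negbTE nba).
rewrite atlas_mx_neq //.
have [avu|nav] := boolP (removable Q u); last by rewrite /=; ring.
have [avy|nav] := boolP (removable Q y); last by rewrite /=; ring.
case: (inQ _ (removable_in avu) (removable_neqz avu)) => ->; case: (inQ _ (removable_in avy) (removable_neqz avy)) => ->;
  rewrite ?eqxx ?(negbTE ab) ?(negbTE ba) /=; ring.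
Qed.

Lemma hyperbolic_atlas_mx_all Q l : all_pos l -> z \in Q -> #|Q| = (size l).+3 ->
  hyperbolic_atlas_mx Q l.
Proof.
elim: l Q => [|h l IH] Q l_gt0 zQ cQ; first exact: hyperbolic_atlas_mx_nil.
apply: hyperbolic_atlas_mx_cons => // u avu.
have [_ ?] := all_pos_cons l_gt0.
by apply: IH; rewrite ?removable_z // (removable_card avu cQ).
Qed.

Lemma removals_log_concave Q h h' l : all_pos [:: h, h' & l] -> z \in Q -> #|Q| = (size l).+3 ->
  removals Q [:: h, h & l] * removals Q [:: h', h' & l] <= removals Q [:: h, h' & l] ^+ 2.
Proof.
move=> pos zQ cQ; rewrite -!bform_atlas_mx_hh; apply: hyperbolic_atlas_mx_all => //.
  by move=> k kl; apply: pos; right; right.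
have [_ pos'] := all_pos_cons pos.
by rewrite bform_atlas_mx_hh removals_ge0 // => k [<-|]; [apply: pos'; left|move=> ?; apply: pos'].
Qed.

(* A positive [eps] makes every product of removals positive, hence the matrices connected. *)
Definition dir (eps : R) (b c : bool) : R := if c == b then 1 else eps.

(** At [eps = 0] this counts the linear extensions of [Q] with [i] elements before [z] and [j] after
    it, see [removals2_0E]. *)
Definition removals2 eps Q i j := removals Q (nseq i (dir eps true) ++ nseq j (dir eps false)).

Lemma removals_nseqC Q l1 l h h' i :
  removals Q (l1 ++ h :: nseq i h' ++ l) = removals Q (l1 ++ nseq i h' ++ h :: l).
Proof.
elim: i l1 => [//|i IH] l1 /=.
by rewrite removals_catC -cat_rcons IH cat_rcons.
Qed.

Lemma all_pos_cat l1 l2 : all_pos l1 -> all_pos l2 -> all_pos (l1 ++ l2).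
Proof. by move=> p1 p2 h /List.in_app_iff[/p1|/p2]. Qed.

Lemma all_pos_nseq i h : (forall b, 0 < h b) -> all_pos (nseq i h).
Proof. by move=> h_gt0; elim: i => [//|i IH] k [<-//|]; exact: IH. Qed.

Lemma dir_gt0 eps b c : 0 < eps -> 0 < dir eps b c.
Proof. by rewrite /dir; case: ifP. Qed.

Lemma removals2_gt0 eps Q i j : 0 < eps -> z \in Q -> #|Q| = (i + j).+1 -> 0 < removals2 eps Q i j.
Proof.
move=> eps_gt0 zQ cQ; apply: removals_gt0 => //.
  by apply: all_pos_cat; apply: all_pos_nseq => b; exact: dir_gt0.
by rewrite size_cat !size_nseq.
Qed.

Lemma removals2_log_concave eps Q i j : 0 < eps -> z \in Q -> #|Q| = (i + j).+3 ->
  removals2 eps Q i j.+2 * removals2 eps Q i.+2 j <= removals2 eps Q i.+1 j.+1 ^+ 2.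
Proof.
move=> eps_gt0 zQ cQ; rewrite /removals2.
set s := dir eps true; set r := dir eps false.
(* All three lists are brought to two leading factors followed by the common tail
   [nseq i s ++ nseq j r]. *)
rewrite mulrC -[X in _ * X <= _](removals_nseqC Q [::]) /= -[X in _ * X <= _](removals_nseqC Q [:: r]).
rewrite -[X in _ <= X ^+ 2](removals_nseqC Q [:: s]) /=.
have dpos b c : 0 < dir eps b c by exact: dir_gt0.
apply: removals_log_concave => //; last by rewrite size_cat !size_nseq.
move=> h [<-|[<-|]]; [exact: dpos|exact: dpos|apply: all_pos_cat; apply: all_pos_nseq] => c; exact: dpos.
Qed.

(** Continuity at [eps = 0] in quantitative form, along the recursion: a removal in the unwanted
    direction costs a factor [eps]. *)
Lemma removals_dir_lipschitz (l : seq bool) Q : exists C : R, 0 <= C /\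
  forall eps, 0 <= eps <= 1 ->
    0 <= removals Q (map (dir 0) l) <= removals Q (map (dir eps) l) /\
    removals Q (map (dir eps) l) <= removals Q (map (dir 0) l) + C * eps.
Proof.
elim: l Q => [|b l IH] Q.
  by exists 0; split=> // eps _ /=; rewrite mul0r addr0 ler01 lexx.
have {IH}[C HC] := choice IH.
pose N eps (y : bool * T) := removals (Q :\ y.2) (map (dir eps) l).
(* For each removal, the first [C] covers a weight 1, and [N 0 y + C] covers a weight [eps], as
   [eps <= 1]. *)
exists (\sum_(y | removable Q y) (C (Q :\ y.2) + (N 0 y + C (Q :\ y.2)))); split.
  apply: sumr_ge0 => y _; have [C0 /(_ 0)] := HC (Q :\ y.2).
  rewrite lexx ler01 => /(_ isT)[/andP[N0 _] _]; rewrite !addr_ge0 //.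
move=> eps eps01; have /andP[eps0 eps1] := eps01.
have N0_ge0 y : 0 <= N 0 y by have [_ /(_ _ eps01)[/andP[]]] := HC (Q :\ y.2).
have N0_le y : N 0 y <= N eps y by have [_ /(_ _ eps01)[/andP[]]] := HC (Q :\ y.2).
have N_le y : N eps y <= N 0 y + C (Q :\ y.2) * eps.
  by have [_ /(_ _ eps01)[]] := HC (Q :\ y.2).
have C_ge0 y : 0 <= C (Q :\ y.2) by have [] := HC (Q :\ y.2).
split; [apply/andP; split|] => /=.
- apply: sumr_ge0 => y _; apply: mulr_ge0; last exact: N0_ge0.
  by rewrite /dir; case: ifP => _; rewrite ?ler01 ?lexx.
- apply: ler_sum => y _; rewrite /dir; case: ifP => _; rewrite ?mul1r ?mul0r; [exact: N0_le|].
  exact: mulr_ge0 eps0 (le_trans (N0_ge0 y) (N0_le y)).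
rewrite mulr_suml -big_split /=; apply: ler_sum => y _.
rewrite -/(N eps y) -/(N 0 y) /dir.
have := N0_ge0 y; have := N0_le y; have := N_le y; have := C_ge0 y.
move: (N 0 y) (N eps y) (C (Q :\ y.2)) => n0 ne c c0 h1 h2 h3.
case: ifP => _; rewrite ?mul1r ?mul0r; nra.
Qed.

(** For positive [eps] no term vanishes, so [log_concave_ratio] applies; its conclusion passes to
    the limit 0. *)
Lemma removals2_0_log_concave Q n a b k : z \in Q -> #|Q| = n.+1 ->
  (a <= b)%N -> (b + k <= n)%N ->
  removals2 0 Q a (n - a) * removals2 0 Q (b + k) (n - (b + k)) <=
  removals2 0 Q (a + k) (n - (a + k)) * removals2 0 Q b (n - b).
Proof.
move=> zQ cQ ab bkn.
pose f eps i := removals2 eps Q i (n - i).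
have lip i : exists C : R, 0 <= C /\ forall eps, 0 <= eps <= 1 ->
    0 <= f 0 i <= f eps i /\ f eps i <= f 0 i + C * eps.
  have [C HC] := removals_dir_lipschitz (nseq i true ++ nseq (n - i) false) Q.
  by exists C; move: HC; setoid_rewrite map_cat; setoid_rewrite map_nseq.
have [Ca [Ca0 Ha]] := lip (a + k)%N; have [Cb [Cb0 Hb]] := lip b.
have fE eps : 0 < eps <= 1 -> f eps a * f eps (b + k)%N <= f eps (a + k)%N * f eps b.
  move=> /andP[e0 e1]; apply: (@log_concave_ratio _ (f eps) n) => //.
    by move=> i i_n; apply: removals2_gt0 => //; rewrite subnKC.
  move=> i i_n; rewrite /f; have [j nE] : exists j, n = (i + j).+2 by exists (n - i.+2)%N; lia.
  have -> : (n - i = j.+2)%N by lia.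
  have -> : (n - i.+2 = j)%N by lia.
  have -> : (n - i.+1 = j.+1)%N by lia.
  by apply: removals2_log_concave => //; rewrite cQ nE.
change (f 0 a * f 0 (b + k)%N <= f 0 (a + k)%N * f 0 b).
have ge00 i : 0 <= f 0 i by have [C [_ /(_ 0)]] := lip i; rewrite lexx ler01 => /(_ isT)[/andP[]].
have le0 i eps : 0 <= eps <= 1 -> f 0 i <= f eps i.
  by move=> e01; have [C [_ /(_ _ e01)[/andP[]]]] := lip i.
have bound eps : 0 < eps <= 1 -> f 0 a * f 0 (b + k)%N <=
    f 0 (a + k)%N * f 0 b + (f 0 (a + k)%N * Cb + Ca * f 0 b + Ca * Cb) * eps.
  move=> /[dup] e01' /andP[e0 e1]; have e01 : 0 <= eps <= 1 by rewrite e1 ltW.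
  apply: le_trans (_ : f eps a * f eps (b + k)%N <= _); first by rewrite ler_pM ?ge00 ?le0.
  apply: le_trans (fE _ e01') _.
  have [_ le1] := Ha _ e01; have [_ le2] := Hb _ e01.
  have g1 := ge00 (a + k)%N; have g2 := ge00 b.
  apply: (@le_trans _ _ ((f 0 (a + k)%N + Ca * eps) * (f 0 b + Cb * eps))).
    by apply: ler_pM => //; apply: le_trans (ge00 _) (le0 _ _ e01).
  rewrite -subr_ge0; set e := (X in 0 <= X).
  have -> : e = Ca * Cb * eps * (1 - eps) by rewrite /e; ring.
  by rewrite !mulr_ge0 // ?subr_ge0 // ltW.
rewrite leNgt; apply/negP => lt.
set D := f 0 (a + k)%N * Cb + _ + _ in bound.
have D0 : 0 <= D by rewrite !addr_ge0 // mulr_ge0.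
set X := f 0 a * _ in bound lt; set Y := f 0 (a + k)%N * f 0 b in bound lt.
(* Small enough that [D * e < X - Y], which contradicts [bound], and at most 1. *)
pose e := (X - Y) / (X - Y + D + D + 1).
have XY : 0 < X - Y by rewrite subr_gt0.
have den : 0 < X - Y + D + D + 1 by lra.
have e0 : 0 < e by rewrite divr_gt0.
have e1 : e <= 1 by rewrite ler_pdivrMr //; lra.
have := bound e; rewrite e0 e1 => /(_ isT).
have eE : e * (X - Y + D + D + 1) = X - Y by rewrite /e mulfVK // gt_eqF.
have : 0 <= e * D by rewrite mulr_ge0 // ltW.
have : 0 < e * (X - Y) by rewrite mulr_gt0.
nra.
Qed.

End Atlas.

(** * The four functions theorem *)

Section FourFunctions.
Variables (R : realDomainType) (d : Order.disp_t) (C : finOrderType d).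

(** Expanding [0 <= (u - x) * (u - y)] and using [x * y <= u * v] gives
    [u * (x + y) <= u * (u + v)]. *)
Lemma four_numbers (u v x y : R) : 0 <= v -> 0 <= x -> 0 <= y ->
  x <= u -> y <= u -> x * y <= u * v -> x + y <= u + v.
Proof.
move=> v_ge0 x_ge0 y_ge0 xu yu xy.
have u_ge0 : 0 <= u := le_trans x_ge0 xu.
have [u0|u_neq0] := eqVneq u 0.
  by rewrite u0 add0r (le_trans _ v_ge0) // -[leRHS]addr0 lerD // -u0.
have u_gt0 : 0 < u by rewrite lt_def u_neq0.
rewrite -(ler_pM2l u_gt0); have : 0 <= (u - x) * (u - y) by rewrite mulr_ge0 ?subr_ge0.
nra.
Qed.

(** Twice each product is a sum over pairs of points. For one pair, [g] at the larger point times
    [e] at the smaller bounds both cross terms, and the instances at equal points bound their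
    product, so [four_numbers] applies. *)
Lemma four_functions_chain (a b g e : C -> R) :
  (forall c, 0 <= a c) -> (forall c, 0 <= b c) -> (forall c, 0 <= g c) -> (forall c, 0 <= e c) ->
  (forall c c', a c * b c' <= g (Order.max c c') * e (Order.min c c')) ->
  (\sum_c a c) * (\sum_c b c) <= (\sum_c g c) * (\sum_c e c).
Proof.
move=> a0 b0 g0 e0 H.
have prodE (p q : C -> R) : (\sum_c p c) * (\sum_c q c) *+ 2 =
    \sum_c \sum_c' (p c * q c' + p c' * q c).
  rewrite mulr2n {1}big_distrlr /= mulrC big_distrlr /= -big_split /=.
  apply: eq_bigr => c _; rewrite -big_split /=; apply: eq_bigr => c' _.
  by rewrite [q c * _]mulrC.
rewrite -(ler_pMn2r (n := 2)) // !prodE; apply: ler_sum => c _; apply: ler_sum => c' _.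
wlog cc' : c c' / (c <= c')%O.
  move=> wl; case: (leP c c') => [|/ltW]; first exact: wl.
  by move/wl; rewrite addrC [leRHS]addrC.
have := H c c'; have := H c' c; rewrite (max_idPl cc') (min_idPr cc') (max_idPr cc') (min_idPl cc').
move=> H1 H2; rewrite [leRHS]addrC.
apply: four_numbers => //; rewrite ?mulr_ge0 //.
have -> : a c * b c' * (a c' * b c) = (a c * b c) * (a c' * b c') by ring.
have -> : g c' * e c * (g c * e c') = (g c * e c) * (g c' * e c') by ring.
have := H c c; have := H c' c'; rewrite !maxxx !minxx => H3 H4.
by apply: ler_pM; rewrite ?mulr_ge0.
Qed.

Variable T : finType.
Implicit Types (f : {ffun T -> C}) (a b g e : {ffun T -> C} -> R).

Definition fmax f f' := [ffun x => Order.max (f x) (f' x)].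
Definition fmin f f' := [ffun x => Order.min (f x) (f' x)].
Definition upd f x c : {ffun T -> C} := [ffun y => if y == x then c else f y].

Fixpoint sum_upd (s : seq T) a f : R :=
  if s is x :: s' then \sum_c sum_upd s' a (upd f x c) else a f.

Lemma sum_upd_ge0 s a f : (forall f, 0 <= a f) -> 0 <= sum_upd s a f.
Proof. by move=> a0; elim: s f => //= x s IH f; exact: sumr_ge0. Qed.

(** Summing out one coordinate preserves the hypothesis, by the case of a chain. *)
Lemma four_functions_upd s a b g e :
  (forall f, 0 <= a f) -> (forall f, 0 <= b f) -> (forall f, 0 <= g f) -> (forall f, 0 <= e f) ->
  (forall f f', a f * b f' <= g (fmax f f') * e (fmin f f')) ->
  forall f f', sum_upd s a f * sum_upd s b f' <=
    sum_upd s g (fmax f f') * sum_upd s e (fmin f f').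
Proof.
move=> a0 b0 g0 e0 H; elim: s => [|x s IH] f f' /=; first exact: H.
apply: four_functions_chain => [c|c|c|c|c c']; rewrite ?sum_upd_ge0 //.
have -> : upd (fmax f f') x (Order.max c c') = fmax (upd f x c) (upd f' x c').
  by apply/ffunP => y; rewrite !ffunE; case: ifP.
have -> : upd (fmin f f') x (Order.min c c') = fmin (upd f x c) (upd f' x c').
  by apply/ffunP => y; rewrite !ffunE; case: ifP.
exact: IH.
Qed.

Lemma sum_updE s a f : uniq s ->
  sum_upd s a f = \sum_(f' : {ffun T -> C} | [forall y, (y \notin s) ==> (f' y == f y)]) a f'.
Proof.
elim: s f => [|x s IH] f /=.
  move=> _; rewrite (big_pred1 f) // => f'; apply/forallP/eqP => [E|-> y] //=.
  by apply/ffunP => y; have := E y; move=> /eqP.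
move=> /andP[xs us].
rewrite (partition_big (fun f' : {ffun T -> C} => f' x) predT) //=.
apply: eq_bigr => c _; rewrite IH //; apply: eq_bigl => f'.
apply/forallP/andP => [E|[/forallP E /eqP fx] y].
  split; last by have := E x; rewrite xs ffunE eqxx.
  apply/forallP => y; apply/implyP; rewrite inE negb_or => /andP[yx ys].
  by have := E y; rewrite ys ffunE (negbTE yx).
apply/implyP => ys; rewrite ffunE; case: (eqVneq y x) => [->|yx]; first by rewrite fx.
by have := E y; rewrite inE negb_or yx ys.
Qed.

Lemma four_functions a b g e :
  (forall f, 0 <= a f) -> (forall f, 0 <= b f) -> (forall f, 0 <= g f) -> (forall f, 0 <= e f) ->
  (forall f f', a f * b f' <= g (fmax f f') * e (fmin f f')) ->
  (\sum_f a f) * (\sum_f b f) <= (\sum_f g f) * (\sum_f e f).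
Proof.
move=> a0 b0 g0 e0 H.
have sumE h f0 : \sum_f h f = sum_upd (enum T) h f0.
  rewrite sum_updE ?enum_uniq //; apply: eq_bigl => f'; apply/esym/forallP => y.
  by rewrite mem_enum.
case: (pickP (@predT {ffun T -> C})) => [f _|none]; last first.
  by rewrite !big_pred0 ?mul0r // => f; have := none f.
rewrite (sumE a f) (sumE b f) (sumE g (fmax f f)) (sumE e (fmin f f)).
exact: four_functions_upd.
Qed.

End FourFunctions.

(** * Log-supermodular weights on subsets *)

Section SetFourFunctions.
Variables (R : realDomainType) (T : finType).
Implicit Types (D : {set T}).

Lemma four_functions_set (a b g e : {set T} -> R) :
  (forall D, 0 <= a D) -> (forall D, 0 <= b D) -> (forall D, 0 <= g D) -> (forall D, 0 <= e D) ->
  (forall D D', a D * b D' <= g (D :|: D') * e (D :&: D')) ->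
  (\sum_D a D) * (\sum_D b D) <= (\sum_D g D) * (\sum_D e D).
Proof.
move=> a0 b0 g0 e0 H; pose st (f : {ffun T -> bool}) := [set x | f x].
have sumE (h : {set T} -> R) : \sum_D h D = \sum_(f : {ffun T -> bool}) h (st f).
  rewrite (reindex st) //; exists (fun D : {set T} => [ffun x => x \in D]) => f _.
    by apply/ffunP => x; rewrite ffunE inE.
  by apply/setP => x; rewrite inE ffunE.
rewrite !sumE; apply: four_functions => // f f'.
have -> : st (fmax f f') = st f :|: st f'.
  by apply/setP => x; rewrite !inE ffunE; case: (f x); case: (f' x).
have -> : st (fmin f f') = st f :&: st f'.
  by apply/setP => x; rewrite !inE ffunE; case: (f x); case: (f' x).
exact: H.
Qed.

Lemma supermodular_meet (mu : {set T} -> R) (X Y Z : pred {set T}) :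
  (forall D, 0 <= mu D) -> (forall D D', mu D * mu D' <= mu (D :|: D') * mu (D :&: D')) ->
  (forall D D', X D -> Y D' -> Z (D :&: D')) ->
  (\sum_(D | X D) mu D) * (\sum_(D | Y D) mu D) <= (\sum_D mu D) * (\sum_(D | Z D) mu D).
Proof.
move=> mu0 lsm XYZ; rewrite (big_mkcond X) (big_mkcond Y) (big_mkcond Z) /=.
apply: (@four_functions_set (fun D => if X D then mu D else 0)
  (fun D => if Y D then mu D else 0) mu (fun D => if Z D then mu D else 0))
  => // [D|D|D|D D']; try by case: ifP.
case: ifP => [XD|_]; last by rewrite mul0r mulr_ge0 //; case: ifP.
case: ifP => [YD|_]; last by rewrite mulr0 mulr_ge0 //; case: ifP.
by rewrite XYZ.
Qed.

Lemma supermodular_join (mu : {set T} -> R) (X Y Z : pred {set T}) :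
  (forall D, 0 <= mu D) -> (forall D D', mu D * mu D' <= mu (D :|: D') * mu (D :&: D')) ->
  (forall D D', X D -> Y D' -> Z (D :|: D')) ->
  (\sum_(D | X D) mu D) * (\sum_(D | Y D) mu D) <= (\sum_D mu D) * (\sum_(D | Z D) mu D).
Proof.
move=> mu0 lsm XYZ; rewrite [leRHS]mulrC (big_mkcond X) (big_mkcond Y) (big_mkcond Z) /=.
apply: (@four_functions_set (fun D => if X D then mu D else 0)
  (fun D => if Y D then mu D else 0) (fun D => if Z D then mu D else 0) mu)
  => // [D|D|D|D D']; try by case: ifP.
case: ifP => [XD|_]; last by rewrite mul0r mulr_ge0 //; case: ifP.
case: ifP => [YD|_]; last by rewrite mulr0 mulr_ge0 //; case: ifP.
by rewrite XYZ.
Qed.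

End SetFourFunctions.

(** * Linear extensions as words *)

Local Open Scope nat_scope.

Section Words.
Variables (T : finType) (lex : rel T).
Implicit Types (Q D : {set T}) (s : seq T).

(** As a list, a linear extension can be shortened at either end or cut at a letter without
    reindexing. *)
Definition linear_word s := pairwise (fun x y => ~~ lex y x) s.

Definition linear_words Q := [seq s <- permutations (enum Q) | linear_word s].

Lemma mem_linear_words Q s : (s \in linear_words Q) = [&& uniq s, [set x in s] == Q & linear_word s].
Proof.
rewrite mem_filter mem_permutations andbC andbA; congr (_ && _).
apply/idP/andP => [pQ|[us /eqP<-]].
  rewrite (perm_uniq pQ) enum_uniq; split=> //; apply/eqP/setP => x.
  by rewrite inE (perm_mem pQ) mem_enum.
by apply: uniq_perm; rewrite ?enum_uniq // => x; rewrite mem_enum inE.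
Qed.

Lemma linear_wordsP Q s : reflect [/\ uniq s, s =i Q & linear_word s] (s \in linear_words Q).
Proof.
rewrite mem_linear_words; apply: (iffP and3P) => -[us sQ ls]; split=> //.
  by move=> x; rewrite -(eqP sQ) inE.
by apply/eqP/setP => x; rewrite inE sQ.
Qed.

Lemma linear_words_uniq Q : uniq (linear_words Q).
Proof. by rewrite filter_uniq // permutations_uniq. Qed.

Lemma size_word Q s : s \in linear_words Q -> size s = #|Q|.
Proof. by case/linear_wordsP => us sQ _; rewrite cardE -(card_uniqP us); rewrite -cardE; apply: eq_card. Qed.

Lemma linear_word_index s x y : linear_word s -> uniq s -> x \in s -> y \in s -> lex x y -> x != y ->
  (index x s < index y s)%N.
Proof.
move=> /(pairwiseP x) ls us xs ys xy nxy; rewrite ltnNge; apply/negP => yx.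
have lt : (index y s < index x s)%N.
  rewrite ltn_neqAle yx andbT; apply: contraNneq nxy => E.
  by rewrite -(nth_index x xs) -E nth_index.
have := ls (index y s) (index x s); rewrite !inE !index_mem => /(_ ys xs lt).
by rewrite !nth_index // xy.
Qed.

End Words.

Lemma linear_word_rev (T : finType) (lex : rel T) (s : seq T) :
  linear_word lex (rev s) = linear_word (fun x y => lex y x) s.
Proof.
rewrite /linear_word; elim: s => [//|x s IH]; rewrite rev_cons -cats1 pairwise_cat /= IH andbT.
by rewrite allrel1r all_rev andbC.
Qed.

Lemma mem_linear_words_rev (T : finType) (lex : rel T) (Q : {set T}) s :
  (rev s \in linear_words lex Q) = (s \in linear_words (fun x y => lex y x) Q).
Proof.
rewrite !mem_linear_words rev_uniq linear_word_rev; congr [&& _, _ == _ & _].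
by apply/setP => x; rewrite !inE mem_rev.
Qed.

Lemma perm_linear_words_rev (T : finType) (lex : rel T) (Q : {set T}) :
  perm_eq (linear_words (fun x y => lex y x) Q) (map rev (linear_words lex Q)).
Proof.
apply: uniq_perm; rewrite ?linear_words_uniq //.
  by rewrite (map_inj_uniq (can_inj revK)) linear_words_uniq.
move=> s; rewrite -mem_linear_words_rev; apply/idP/mapP => [ss|[t tw ->]].
  by exists (rev s); rewrite ?revK.
by rewrite revK.
Qed.

(** * Arithmetic for the comparison of leading coefficients *)

Lemma lex_le a b c e m : (a * m + c <= b * m + e -> e < m -> a <= b)%N.
Proof. by move=> le lt; rewrite leqNgt; apply/negP => ba; nia. Qed.

Lemma leq_max_ord n (a a' b b' : 'I_n) : (a <= b -> a' <= b' ->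
  Order.max a a' <= Order.max b b')%N.
Proof. by rewrite /Order.max; do 2 case: ifP; rewrite !ltEord; lia. Qed.

Lemma leq_min_ord n (a a' b b' : 'I_n) : (a <= b -> a' <= b' ->
  Order.min a a' <= Order.min b b')%N.
Proof. by rewrite /Order.min; do 2 case: ifP; rewrite !ltEord; lia. Qed.

Lemma ffact_ge m k : (m ^ k <= (m + k) ^_ k)%N.
Proof.
elim: k => [//|k IH]; rewrite addnS ffactSS expnS leq_mul //; lia.
Qed.

Lemma ffact_le_exp n k c : (n <= c -> n ^_ k <= c ^ k)%N.
Proof.
elim: k n => [//|k IH] n nc; rewrite ffactnS expnS leq_mul // IH //; lia.
Qed.

Lemma fact_mul_le b c e : (b <= c -> (b + e)`! * c`! <= (c + e)`! * b`!)%N.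
Proof.
move=> bc; elim: e => [|e IH]; first by rewrite !addn0 mulnC.
rewrite !addnS !factS -!mulnA leq_mul //; lia.
Qed.

(** Bernoulli's inequality for the n-th power of 1 - c / (m + c), cleared of denominators. *)
Lemma bernoulli_nat m c n :
  ((m + c) ^ n * (m + c) <= m ^ n * (m + c) + n * c * (m + c) ^ n)%N.
Proof.
elim: n => [|n IH]; first by rewrite !expn0; lia.
have le : (m ^ n <= (m + c) ^ n)%N by have [->//|n0] := posnP n; rewrite leq_exp2r // leq_addr.
move: le IH; rewrite !expnS; move: ((m + c) ^ n)%N (m ^ n)%N => p q qp IH.
have : ((m + c) * (p * (m + c)) <= (m + c) * (q * (m + c) + n * c * p))%N by rewrite leq_mul.
have : (c * q * (m + c) <= c * p * (m + c))%N by rewrite leq_mul // leq_mul.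
nia.
Qed.

(** The n-th power of (m + c) / m tends to 1. The chosen [m] exceeds the error term [A * n * c] of
    Bernoulli's inequality, which excludes [B + 1 <= A]. *)
Lemma leq_of_leq_pow A B c n : (forall m, A * m ^ n <= B * (m + c) ^ n)%N -> (A <= B)%N.
Proof.
move=> H; rewrite leqNgt; apply/negP => BA.
pose m := (A * n * c).+1; have := H m; have := bernoulli_nat m c n.
have : (0 < (m + c) ^ n)%N by rewrite expn_gt0.
move: (leqnn m); rewrite {1}/m; move: ((m + c) ^ n)%N (m ^ n)%N => p q mA p0 bern H'.
have h1 : (A * (p * (m + c)) <= A * (q * (m + c) + n * c * p))%N by rewrite leq_mul.
have h2 : (A * q * (m + c) <= B * p * (m + c))%N by rewrite leq_mul.
have h3 : (p * (A * (m + c)) <= p * (B * (m + c) + A * n * c))%N by lia.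
rewrite leq_pmul2l // in h3.
have h4 : ((B + 1) * (m + c) <= A * (m + c))%N by rewrite leq_mul // addn1.
lia.
Qed.

(** * Order-preserving maps into a chain *)

Section Omega.
Variables (T : finType) (lex : rel T).
Hypotheses (lexx_refl : reflexive lex) (lex_anti : antisymmetric lex)
  (lex_trans : transitive lex).
Implicit Types (Q D : {set T}) (s : seq T).

Definition num_linext D := size (linear_words lex D).

(* The value [ord_max] off [D] turns intersections and unions of the sets [D] into
   pointwise maxima and minima of maps. *)
Definition top_maps N D := [set f : {ffun T -> 'I_N.+1} |
  [forall x, forall y, lex x y ==> (f x <= f y)%N] &&
  [forall x, (x \notin D) ==> (f x == ord_max)]].

Lemma top_mapsP N D (f : {ffun T -> 'I_N.+1}) :
  reflect ((forall x y, lex x y -> (f x <= f y)%N) /\ (forall x, x \notin D -> f x = ord_max))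
    (f \in top_maps N D).
Proof.
rewrite inE; apply: (iffP andP) => -[mono off]; split.
- by move=> x y; move/forallP/(_ x)/forallP/(_ y)/implyP: mono.
- by move=> x xD; move/forallP/(_ x)/implyP/(_ xD)/eqP: off.
- by apply/forallP => x; apply/forallP => y; apply/implyP/mono.
- by apply/forallP => x; apply/implyP => xD; apply/eqP/off.
Qed.

Definition down_closed D := forall x y, lex x y -> y \in D -> x \in D.

Definition fill N s (t : seq 'I_N.+1) : {ffun T -> 'I_N.+1} :=
  [ffun x => nth ord_max t (index x s)].

Lemma map_fill N s (t : seq 'I_N.+1) : uniq s -> size t = size s ->
  map (fill s t) s = t.
Proof.
move=> us st; apply: (@eq_from_nth _ ord_max) => [|i]; rewrite size_map // => is_.
case: s us st is_ => [//|x0 s] us st is_.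
by rewrite (nth_map x0) // ffunE index_uniq.
Qed.

(** Strictly increasing values along a word determine the word, by sorting [D] by value; so distinct
    pairs of a word and a list of values give distinct maps. *)
Lemma top_maps_lower N D : down_closed D -> (num_linext D * 'C(N.+1, #|D|) <= #|top_maps N D|)%N.
Proof.
move=> dc; pose W := [set t : #|D|.-tuple 'I_N.+1 | sorted ltn (map val t)].
rewrite -card_ltn_sorted_tuples -/W (cardE W) /num_linext.
rewrite -(size_allpairs (fun s (t : #|D|.-tuple 'I_N.+1) => fill s t)) (cardE (top_maps N D)).
apply: uniq_leq_size.
  apply: allpairs_uniq; rewrite ?linear_words_uniq ?enum_uniq //.
  move=> [s t] [s' t'] /allpairsP[[s1 t1] /= [s1w t1w [-> ->]]].
  move=> /allpairsP[[s2 t2] /= [s2w t2w [-> ->]]] /= fE.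
  have sz1 : size t1 = size s1 by rewrite size_tuple (size_word s1w).
  have sz2 : size t2 = size s2 by rewrite size_tuple (size_word s2w).
  have [/linear_wordsP[u1 D1 _] /linear_wordsP[u2 D2 _]] := (s1w, s2w).
  have srt s0 (t0 : #|D|.-tuple 'I_N.+1) : uniq s0 -> size t0 = size s0 -> t0 \in enum W ->
      sorted (relpre (fun x => val (fill s0 t0 x)) ltn) s0.
    move=> us szt; rewrite mem_enum inE -{1}(map_fill us szt) -map_comp.
    by rewrite sorted_map.
  have E : s1 = s2.
    apply: (@irr_sorted_eq _ (relpre (fun x => val (fill s1 t1 x)) ltn)).
    - by move=> a b c /=; exact: ltn_trans.
    - by move=> a /=; rewrite ltnn.
    - exact: srt.
    - by rewrite fE; exact: srt.
    - by move=> x; rewrite D1 D2.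
  congr (_, _); first exact: E.
  by apply: val_inj; rewrite /= -(map_fill u1 sz1) -(map_fill u2 sz2) fE E.
move=> f /allpairsP[[s t] /= [sw tw ->]]; rewrite mem_enum.
have /linear_wordsP[us sD ls] := sw; have szt : size t = size s by rewrite size_tuple (size_word sw).
apply/top_mapsP; split=> [x y xy|x xD]; last first.
  by rewrite ffunE nth_default // szt leqNgt index_mem sD.
rewrite !ffunE; have [yD|yD] := boolP (y \in D); last first.
  by rewrite [nth _ t (index y s)]nth_default ?leq_ord // szt leqNgt index_mem sD.
have [->//|nxy] := eqVneq x y.
have xs : x \in s by rewrite sD (dc _ _ xy).
have ys : y \in s by rewrite sD.
have := linear_word_index ls us xs ys xy nxy.
move: tw; rewrite mem_enum inE => srt lt.
have := sorted_ltn_nth ltn_trans (val (@ord_max N)) srt.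
move=> /(_ (index x s) (index y s)); rewrite !inE size_map szt !index_mem => /(_ xs ys lt).
by rewrite !(nth_map ord_max) ?szt ?index_mem //; exact: ltnW.
Qed.

(** Sorting [D] by value gives a linear word along which the map increases weakly, provided ties are
    broken compatibly with the order: [key] compares values first, then the numbers of elements
    below. *)
Lemma top_maps_upper N D : (#|top_maps N D| <= num_linext D * 'C(#|D| + N, #|D|))%N.
Proof.
pose W := [set t : #|D|.-tuple 'I_N.+1 | sorted leq (map val t)].
rewrite -card_sorted_tuples -/W (cardE W) /num_linext.
rewrite -(size_allpairs (fun s (t : #|D|.-tuple 'I_N.+1) => fill s t)) (cardE (top_maps N D)).
apply: uniq_leq_size; first exact: enum_uniq.
move=> f; rewrite mem_enum => /top_mapsP[mono off].
pose down x := #|[set y | lex y x]|.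
pose key x := (f x * #|T|.+1 + down x)%N.
have down_lt x : (down x < #|T|.+1)%N by rewrite ltnS max_card.
pose s := sort (relpre key leq) (enum D).
have leq_tot : total (relpre key leq) by move=> x y /=; exact: leq_total.
have key_tr : transitive (relpre key leq) by move=> y x z /=; exact: leq_trans.
have us : uniq s by rewrite sort_uniq enum_uniq.
have sD : s =i D by move=> x; rewrite mem_sort mem_enum.
have srt : sorted (relpre key leq) s by exact: sort_sorted.
have down_sub x y : lex x y -> x != y -> (down x < down y)%N.
  move=> xy nxy; apply: proper_card; apply/properP; split.
    by apply/subsetP => c; rewrite !inE => cx; exact: lex_trans cx xy.
  exists y; rewrite !inE ?lexx_refl //; apply: contraNN nxy => yx.
  by apply/eqP/lex_anti; rewrite xy yx.
have ls : linear_word lex s.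
  have uss : pairwise (fun x y => x != y) s by rewrite -uniq_pairwise.
  move: srt uss; rewrite (sorted_pairwise key_tr) => srt uss.
  have : pairwise (fun x y => (key x <= key y)%N && (x != y)) s by rewrite pairwise_relI srt uss.
  apply: sub_pairwise => x y /andP[kxy nxy]; apply/negP => yx.
  have := down_sub _ _ yx; rewrite eq_sym => /(_ nxy) lt.
  have fxy : (f x <= f y)%N := lex_le kxy (down_lt y).
  have E : nat_of_ord (f x) = f y by apply/eqP; rewrite eqn_leq fxy mono.
  by move: kxy; rewrite /key E leq_add2l leqNgt lt.
have sw : s \in linear_words lex D by apply/linear_wordsP.
have fs : size (map f s) == #|D| by rewrite size_map (size_word sw).
apply/allpairsP; exists (s, Tuple fs) => /=; split=> //.
  rewrite mem_enum inE /= -map_comp sorted_map; apply: sub_sorted srt => x y /=.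
  by move=> kxy; exact: lex_le kxy (down_lt y).
apply/ffunP => x; rewrite ffunE; have [xD|xD] := boolP (x \in D).
  by rewrite (nth_map x) ?nth_index ?index_mem ?sD.
by rewrite nth_default ?off // size_map leqNgt index_mem sD.
Qed.

Lemma top_maps_supermodular N D D' :
  (#|top_maps N D| * #|top_maps N D'| <= #|top_maps N (D :|: D')| * #|top_maps N (D :&: D')|)%N.
Proof.
rewrite -(ler_nat int) !natrM.
have cE (A : {set {ffun T -> 'I_N.+1}}) : (#|A|%:R = \sum_f (f \in A)%:R :> int)%R.
  by rewrite -sum1_card natr_sum big_mkcond /=; apply: eq_bigr => f _; case: ifP.
rewrite !cE [leRHS]mulrC; apply: four_functions => // f f'.
rewrite -!natrM !mulnb ler_nat; case: andP => // -[/top_mapsP[m o] /top_mapsP[m' o']].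
have -> : fmax f f' \in top_maps N (D :&: D').
  apply/top_mapsP; split=> [x y xy|x]; rewrite !ffunE.
    exact: leq_max_ord (m _ _ xy) (m' _ _ xy).
  rewrite inE negb_and => /orP[/o|/o'] ->.
    by apply/max_idPl; rewrite leEord leq_ord.
  by apply/max_idPr; rewrite leEord leq_ord.
have -> // : fmin f f' \in top_maps N (D :|: D').
apply/top_mapsP; split=> [x y xy|x]; rewrite !ffunE.
  exact: leq_min_ord (m _ _ xy) (m' _ _ xy).
by rewrite inE negb_or => /andP[/o-> /o'->]; rewrite minxx.
Qed.

Lemma num_linext_supermodular D D' : down_closed D -> down_closed D' ->
  (num_linext D * num_linext D' <= num_linext (D :|: D') * num_linext (D :&: D'))%N.
Proof.
move=> dc dc'; pose k := #|D|; pose k' := #|D'|.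
pose a := #|D :|: D'|; pose b := #|D :&: D'|.
have abk : (a + b = k + k')%N by exact: cardsUI.
have bk : (b <= k)%N by apply/subset_leq_card/subsetIl.
have bk' : (b <= k')%N by apply/subset_leq_card/subsetIr.
set X := (X in (X <= _)%N); set Y := (Y in (_ <= Y)%N).
have fac : (k`! * k'`! <= a`! * b`!)%N.
  by have := fact_mul_le (k - b) bk'; rewrite subnKC // (_ : k' + (k - b) = a)%N //; lia.
suff H : (X * (a`! * b`!) <= Y * (k`! * k'`!))%N.
  rewrite -(leq_pmul2r (m := a`! * b`!)) ?muln_gt0 ?fact_gt0 //.
  by apply: leq_trans H _; rewrite leq_mul.
pose n := (k + k')%N.
(* With [N = m + n], the falling factorials on the left are at least powers of [m], those on the
   right at most powers of [m + (n + n)]. *)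
apply: (@leq_of_leq_pow _ _ (n + n) n) => m.
pose N := (m + n)%N.
have main : (X * ('C(N.+1, k) * 'C(N.+1, k')) <= Y * ('C(a + N, a) * 'C(b + N, b)))%N.
  apply: (@leq_trans (#|top_maps N D| * #|top_maps N D'|)%N).
    by rewrite /X mulnACA leq_mul // top_maps_lower.
  apply: leq_trans (top_maps_supermodular N D D') _.
  by rewrite /Y mulnACA leq_mul // top_maps_upper.
have {main} main : (X * (a`! * b`!) * (N.+1 ^_ k * N.+1 ^_ k') <=
             Y * (k`! * k'`!) * ((a + N) ^_ a * (b + N) ^_ b))%N.
  rewrite -!bin_ffact; move: main.
  move: 'C(N.+1, k) 'C(N.+1, k') 'C(a + N, a) 'C(b + N, b) => c1 c2 c3 c4 main.
  have : (X * (c1 * c2) * (a`! * b`! * k`! * k'`!) <= Y * (c3 * c4) * (a`! * b`! * k`! * k'`!))%N.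
    by rewrite leq_mul.
  by congr (_ <= _)%N; lia.
apply: (@leq_trans (X * (a`! * b`!) * (N.+1 ^_ k * N.+1 ^_ k'))%N).
  rewrite leq_mul // {1}/n expnD.
  have low j : (j <= n)%N -> (m ^ j <= N.+1 ^_ j)%N.
    move=> jn; have -> : N.+1 = (N.+1 - j + j)%N by rewrite /N; lia.
    apply: leq_trans (ffact_ge _ _).
    have [->//|j0] := posnP j.
    by rewrite leq_exp2r // /N; lia.
  by rewrite leq_mul // low // /n; lia.
apply: leq_trans main _; rewrite leq_mul // {3}/n -abk expnD.
by rewrite leq_mul // ffact_le_exp // /N /n; lia.
Qed.

End Omega.

(** * The law of the set below an element *)

Section BelowLaw.
Variables (T : finType) (lex : rel T).
Hypotheses (lexx_refl : reflexive lex) (lex_anti : antisymmetric lex)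
  (lex_trans : transitive lex).
Variable x : T.
Implicit Types (D : {set T}) (s : seq T).

Let rlex : rel T := fun y y' => lex y' y.

Definition below_set s := [set y | (index y s < index x s)%N].

Definition below_count D := count (fun s => below_set s == D) (linear_words lex setT).

Lemma sum_below_count (X : pred {set T}) :
  \sum_(D | X D) below_count D = count (fun s => X (below_set s)) (linear_words lex setT).
Proof.
rewrite -sum1_count big_mkcond /=.
under eq_bigr => D _.
  rewrite /below_count -sum1_count (_ : (if X D then _ else _) =
    \sum_(s <- linear_words lex setT | X (below_set s) && (below_set s == D)) 1); last first.
    case: ifP => XD.
      by apply: eq_bigl => s; case: eqP => [->|]; rewrite ?XD ?andbF.
    by rewrite big1 // => s /andP[+ /eqP E]; rewrite E XD.
  over.
rewrite -(partition_big below_set predT) //=.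
Qed.

Definition cut D := [/\ x \notin D, down_closed lex D & down_closed lex (x |: D)].

Lemma word_mem s y : s \in linear_words lex setT -> y \in s.
Proof. by case/linear_wordsP => _ sT _; rewrite sT inE. Qed.

Lemma cut_below_set s : s \in linear_words lex setT -> cut (below_set s).
Proof.
move=> sw; have /linear_wordsP[us _ ls] := sw.
have ys y : y \in s := word_mem y sw.
have mono y y' : lex y y' -> (index y s <= index y' s)%N.
  have [->//|nyy] := eqVneq y y'; move=> yy; exact: ltnW (linear_word_index ls us (ys y) (ys y') yy nyy).
split; first by rewrite inE ltnn.
  by move=> y y' yy; rewrite !inE; exact: leq_ltn_trans (mono _ _ yy).
move=> y y' yy; rewrite !inE => /orP[/eqP E|lt]; last first.
  by rewrite (leq_ltn_trans (mono _ _ yy) lt) orbT.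
have := mono _ _ yy; rewrite E leq_eqVlt => /orP[/eqP ix|->]; last by rewrite orbT.
by rewrite -(nth_index x (ys y)) ix nth_index ?eqxx.
Qed.

(** Such a word is cut at [x] into a word of [D] and a word of the remaining elements, which are
    independent of each other. *)
Lemma below_count_cut D : cut D -> below_count D = (num_linext lex D * num_linext lex (~: (x |: D)))%N.
Proof.
move=> [xD dc dcx]; rewrite /below_count -size_filter /num_linext.
rewrite -(size_allpairs (fun s1 s2 => s1 ++ x :: s2)); apply: perm_size.
apply: uniq_perm.
- by rewrite filter_uniq ?linear_words_uniq.
- apply: allpairs_uniq; rewrite ?linear_words_uniq // => -[s1 s2] [t1 t2].
  move=> /allpairsP[[a1 a2] /= [aw1 aw2 [-> ->]]] /allpairsP[[b1 b2] /= [bw1 bw2 [-> ->]]] /eqP.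
  rewrite eqseq_cat; last by rewrite (size_word aw1) (size_word bw1).
  by move=> /andP[/eqP-> /eqP[->]].
move=> s; rewrite mem_filter; apply/andP/allpairsP.
  move=> [/eqP sD sw]; have /linear_wordsP[us _ ls] := sw.
  have xs := word_mem x sw.
  pose i := index x s; pose s1 := take i s; pose s2 := drop i.+1 s.
  have sE : s = s1 ++ x :: s2.
    by rewrite -[LHS](cat_take_drop i) (drop_nth x) ?index_mem // nth_index.
  have us' := us; rewrite sE cat_uniq /= negb_or in us'.
  case/and3P: us' => us1 /andP[xs1 _] /andP[xs2 us2].
  have in1 y : (y \in s1) = (y \in D).
    by rewrite -sD inE in_take_leq ?index_size // ltnW // index_mem.
  exists (s1, s2); split=> //=.
    apply/linear_wordsP; split=> //.
    by move: ls; rewrite /linear_word sE pairwise_cat => /and3P[].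
  apply/linear_wordsP; split=> //; last first.
    by move: ls; rewrite /linear_word sE pairwise_cat /= => /and3P[_ _ /andP[]].
  move=> y; rewrite !inE negb_or -in1.
  have := word_mem y sw; rewrite sE mem_cat inE.
  have [->|yx] /= := eqVneq y x; first by rewrite (negbTE xs2).
  have [y1|y1] /= := boolP (y \in s1).
    move: us; rewrite sE cat_uniq => /and3P[_ /hasPn h _]; have := h y.
    by rewrite inE; case: (y \in s2) => //; rewrite orbT => /(_ isT); rewrite /= y1.
  by move=> ->.
move=> [[s1 s2] /= [/linear_wordsP[us1 D1 ls1] /linear_wordsP[us2 E2 ls2] ->]].
have x1 : x \notin s1 by rewrite D1.
have x2 : x \notin s2 by rewrite E2 !inE eqxx.
have idx : index x (s1 ++ x :: s2) = size s1.
  by rewrite index_cat (negbTE x1) /= eqxx addn0.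
split.
  apply/eqP/setP => y; rewrite inE idx index_cat -D1; case: ifP => y1.
    by rewrite index_mem.
  by rewrite ltnNge leq_addr.
apply/linear_wordsP; split.
- rewrite cat_uniq us1 /= x2 us2 (negbTE x1) /= andbT.
  by apply/hasPn => y; rewrite E2 !inE negb_or /= => /andP[_]; rewrite D1.
- by move=> y; rewrite mem_cat !inE D1 E2 !inE; case: (y == x); case: (y \in D).
rewrite /linear_word pairwise_cat /= -/(linear_word lex s1) -/(linear_word lex s2) ls1 ls2 andbT /=.
apply/andP; split.
  apply/allrelP => y y'; rewrite D1 inE => yD /orP[/eqP->|].
    by apply: contraNN xD => xy; exact: dc xy yD.
  rewrite E2 !inE negb_or => /andP[_]; apply: contraNN => y'y; exact: dc y'y yD.
apply/allP => y; rewrite E2 => yE; apply: contraTN yE => yx.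
by rewrite inE negbK; apply: dcx yx _; rewrite !inE eqxx.
Qed.

Lemma num_linext_flip D : num_linext lex D = num_linext rlex D.
Proof. by rewrite /num_linext (perm_size (perm_linear_words_rev lex D)) size_map. Qed.

(** For cuts both factors of [below_count_cut] are log-supermodular, the upper one by reversing the
    order, in which complements are down-closed. If [D] or [D'] is not a cut, the left side
    vanishes. *)
Lemma below_count_supermodular D D' :
  (below_count D * below_count D' <= below_count (D :|: D') * below_count (D :&: D'))%N.
Proof.
have below_count_gt0 E : (0 < below_count E)%N -> cut E.
  by rewrite /below_count -has_count => /hasP[s sw /eqP<-]; exact: cut_below_set.
have [->//|/below_count_gt0 cD] := posnP (below_count D).
have [->|/below_count_gt0 cD'] := posnP (below_count D'); first by rewrite muln0.
have [[xD dc dcx] [xD' dc' dcx']] := (cD, cD').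
have up E : down_closed lex (x |: E) -> down_closed rlex (~: (x |: E)).
  by move=> dE y y' yy; rewrite !in_setC; apply: contraNN; exact: dE yy.
have cI : cut (D :&: D').
  split; first by rewrite inE negb_and xD.
    by move=> y y' yy; rewrite !inE => /andP[yD yD']; rewrite (dc _ _ yy yD) (dc' _ _ yy yD').
  move=> y y' yy; rewrite setUIr !in_setI => /andP[yD yD'].
  by rewrite (dcx _ _ yy yD) (dcx' _ _ yy yD').
have cU : cut (D :|: D').
  split; first by rewrite inE negb_or xD.
    by move=> y y' yy; rewrite !inE => /orP[yD|yD']; rewrite ?(dc _ _ yy yD) ?(dc' _ _ yy yD') ?orbT.
  move=> y y' yy; rewrite setUUr !(in_setU _ (x |: D)) => /orP[yD|yD'].
    by rewrite (dcx _ _ yy yD).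
  by rewrite (dcx' _ _ yy yD') orbT.
rewrite !below_count_cut //.
have -> : ~: (x |: (D :|: D')) = ~: (x |: D) :&: ~: (x |: D') by rewrite setUUr setCU.
have -> : ~: (x |: (D :&: D')) = ~: (x |: D) :|: ~: (x |: D') by rewrite setUIr setCI.
rewrite mulnACA [leqRHS]mulnACA leq_mul //; first exact: num_linext_supermodular.
rewrite !num_linext_flip [leqRHS]mulnC; apply: num_linext_supermodular; try exact: up.
- by move=> y; exact: lexx_refl.
- by move=> y y' /andP[? ?]; apply: lex_anti; apply/andP.
- by move=> y y' y'' /= h1 h2; exact: lex_trans h2 h1.
Qed.

End BelowLaw.

Lemma index_rev (T : eqType) (s : seq T) z : uniq s -> z \in s ->
  index z (rev s) = (size s - (index z s).+1)%N.
Proof.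
move=> us zs; have zi : (index z s < size s)%N by rewrite index_mem.
rewrite -{1}(nth_index z zs) -[s in nth z s]revK nth_rev size_rev // index_uniq ?rev_uniq ?size_rev //.
lia.
Qed.

(** * The position of an element, by removals *)

Section Positions.
Variables (T : finType) (z : T).
Implicit Types (lex : rel T) (Q : {set T}) (s : seq T).

Definition position_count lex Q i := count (fun s => index z s == i) (linear_words lex Q).

(** If [z] is not in front, the first letter is a minimal element other than [z], and deleting it
    lowers the index of [z] by one. *)
Lemma position_count_head lex Q i :
  position_count lex Q i.+1 = \sum_(y | removable lex z Q (true, y)) position_count lex (Q :\ y) i.
Proof.
pose A := [set y | removable lex z Q (true, y)].
pose W y := [seq s <- linear_words lex (Q :\ y) | index z s == i].
rewrite /position_count -size_filter.
transitivity (size [seq y :: s | y <- enum A, s <- W y]); last first.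
  rewrite size_allpairs_dep sumnE big_map big_enum /=.
  by apply: eq_big => [y|y _]; [rewrite inE|rewrite size_filter].
apply: perm_size; apply: uniq_perm.
- by rewrite filter_uniq ?linear_words_uniq.
- apply: (@allpairs_uniq_dep _ (fun=> seq T)); rewrite ?enum_uniq //.
    by move=> y _; rewrite filter_uniq ?linear_words_uniq.
  by move=> [y s] [y' s'] _ _ /= [-> ->].
move=> s; rewrite mem_filter; apply/andP/(@allpairsPdep _ (fun=> seq T)).
  move=> [si /linear_wordsP[us sQ ls]]; case: s si us sQ ls => [//|y s] /=.
  case: (eqVneq y z) => // yz; rewrite eqSS => si /andP[ys us] sQ /andP[/allP ly ls].
  exists y, s; split=> //.
    rewrite mem_enum inE; apply/removableP; split=> //=; first by rewrite -sQ inE eqxx.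
    move=> v; rewrite -sQ inE => /orP[/eqP//|vs] vy.
    by have := ly v vs; rewrite vy.
  rewrite mem_filter si; apply/linear_wordsP; split=> // v.
  by rewrite !inE -sQ inE; have [->|//] := eqVneq v y; rewrite (negbTE ys).
move=> [y [s' [yA]]]; rewrite mem_filter => /andP[si /linear_wordsP[us sQ ls]] -> /=.
move: yA; rewrite mem_enum inE => /removableP[yQ /= yz ymin].
rewrite (negbTE yz) eqSS si; split=> //; apply/linear_wordsP; split=> /=.
- by rewrite us sQ !inE eqxx.
- move=> v; rewrite inE sQ !inE; by have [->|] := eqVneq v y.
apply/andP; split=> //; apply/allP => v; rewrite sQ !inE => /andP[vy vQ].
by apply: contraNN vy => /(ymin _ vQ)->.
Qed.

Lemma position_count_rev lex Q i j : z \in Q -> #|Q| = (i + j).+1 ->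
  position_count lex Q i = position_count (fun x y => lex y x) Q j.
Proof.
move=> zQ cQ; rewrite /position_count (permP (perm_linear_words_rev lex Q)) count_map.
apply: eq_in_count => s sw /=; have /linear_wordsP[us sQ _] := sw.
have zs : z \in s by rewrite sQ.
have := zs; rewrite -index_mem index_rev // (size_word sw) cQ => zi.
by apply/eqP/eqP; lia.
Qed.

(** With [z] in front, letters are taken from the end instead: this is [position_count_head] for the
    reversed order. *)
Lemma position_count_last lex Q j : z \in Q -> #|Q| = j.+2 ->
  position_count lex Q 0 = \sum_(y | removable lex z Q (false, y)) position_count lex (Q :\ y) 0.
Proof.
move=> zQ cQ; rewrite (@position_count_rev lex Q 0 j.+1) ?cQ // position_count_head.
apply: eq_bigr => y avy; rewrite (@position_count_rev lex _ 0 j) //.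
  exact: removable_z avy zQ.
by rewrite (removable_card avy cQ).
Qed.

Lemma position_count_set1 lex : position_count lex [set z] 0 = 1.
Proof.
rewrite /position_count (_ : linear_words _ _ = [:: [:: z]]) /= ?eqxx //.
by rewrite /linear_words enum_set1.
Qed.

(** At weight 0 only the prescribed directions survive: the first [i] removals spell the letters
    before [z], the last [j] those after it, read from the end. *)
Lemma removals2_0E (R : realType) lex Q i j : z \in Q -> #|Q| = (i + j).+1 ->
  removals2 lex z (0 : R)%R Q i j = (position_count lex Q i)%:R%R.
Proof.
have sum_bool (b : bool) Q' (F : T -> R) :
    (\sum_(p | removable lex z Q' p) dir 0 b p.1 * F p.2 = \sum_(y | removable lex z Q' (b, y)) F y)%R.
  rewrite (bigID (fun p : bool * T => p.1 == b)) /= [X in (_ + X)%R]big1 ?addr0; last first.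
    by move=> p /andP[_ /negbTE pb]; rewrite /dir pb mul0r.
  rewrite (reindex (fun y : T => (b, y))) /=; last first.
    by exists snd => // -[c y] /andP[_ /eqP/= ->].
  apply: eq_big => [y|y]; first by rewrite eqxx andbT.
  by rewrite /dir eqxx mul1r.
elim: i Q => [|i IHi] Q; last first.
  move=> zQ cQ; rewrite /removals2 /= (sum_bool _ _ (fun y => removals2 lex z 0%R (Q :\ y) i j)).
  rewrite position_count_head natr_sum; apply: eq_bigr => y avy; apply: IHi.
    exact: removable_z avy zQ.
  exact: removable_card avy cQ.
elim: j Q => [|j IHj] Q zQ cQ.
  have -> : Q = [set z].
    by move/eqP/cards1P: cQ zQ => [c ->]; rewrite inE => /eqP->.
  by rewrite position_count_set1.
rewrite /removals2 /= (sum_bool _ _ (fun y => removals2 lex z 0%R (Q :\ y) 0 j)).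
rewrite (position_count_last _ zQ cQ) natr_sum; apply: eq_bigr => y avy; apply: IHj.
  exact: removable_z avy zQ.
exact: removable_card avy cQ.
Qed.

End Positions.

Local Open Scope ring_scope.

Lemma position_count_log_concave (R : realType) (T : finType) (lex : rel T) (z : T) (Q : {set T}) n a b k :
  reflexive lex -> antisymmetric lex -> transitive lex ->
  z \in Q -> #|Q| = n.+1 -> (a <= b)%N -> (b + k <= n)%N ->
  (position_count z lex Q a * position_count z lex Q (b + k) <= position_count z lex Q (a + k) * position_count z lex Q b)%N.
Proof.
move=> lexx lex_anti lex_tr zQ cQ ab bkn; rewrite -(ler_nat R) !natrM.
have := removals2_0_log_concave R lexx lex_anti lex_tr zQ cQ ab bkn.
by rewrite !removals2_0E // cQ; congr _.+1; lia.
Qed.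

(** * Second moment of a log-concave sequence with a large first term *)

Lemma second_moment (R : realFieldType) (a : nat -> R) (c : R) (K : nat) :
  (forall j, 0 <= a j) -> (forall M, \sum_(0 <= j < M) a j <= 1) ->
  0 < c -> c <= a 0%N -> 2 <= c * K%:R ->
  (forall j k, a (j + k)%N * a 0%N <= a k * a j) ->
  forall M, \sum_(0 <= j < M) j%:R ^+ 2 * a j <= 10 * K%:R ^+ 2.
Proof.
move=> a_ge0 a_sum c_gt0 ca cK lc M.
have a0_gt0 : 0 < a 0%N by apply: lt_le_trans ca.
(* If the [K] terms after [a 0] all exceeded half of it, they would sum to at least [c * K / 2],
   hence to at least 1, and [a 0] would push the total above 1. *)
have [k /andP[k_gt0 kK] ak] : exists2 k, (0 < k <= K)%N & 2 * a k <= a 0%N.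
  case: (boolP [exists k : 'I_K, 2 * a k.+1 <= a 0%N]) => [/existsP[k ak]|].
    by exists k.+1 => //; exact: (ltn_ord k).
  rewrite negb_exists => /forallP big; have := a_sum K.+1.
  rewrite big_nat_recl //= leNgt => /negP[].
  have : \sum_(0 <= i < K) c / 2 <= \sum_(0 <= i < K) a i.+1.
    rewrite big_nat_cond [leRHS]big_nat_cond; apply: ler_sum => i; rewrite andbT /= => iK.
    by have := big (Ordinal iK); rewrite -ltNge /= ; lra.
  rewrite sumr_const_nat subn0 -mulr_natr; lra.
(* Log-concavity repeats the halving every [k] steps. *)
have half j : a (j + k)%N <= a j / 2.
  rewrite -(ler_pM2r a0_gt0); apply: le_trans (lc j k) _.
  have := a_ge0 j; nra.
set V := \sum_(0 <= j < M) _.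
have V_le : V <= k%:R ^+ 2 + \sum_(0 <= j < M) (j + k)%:R ^+ 2 * a (j + k)%N.
  apply: (@le_trans _ _ (\sum_(0 <= j < k + M) j%:R ^+ 2 * a j)).
    rewrite /V addnC [leRHS](big_cat_nat _ (n := M)) ?leq_addr //= lerDl.
    by apply: sumr_ge0 => j _; rewrite mulr_ge0 ?sqr_ge0.
  rewrite (big_cat_nat _ (n := k)) ?leq_addr //=; apply: lerD.
    apply: (@le_trans _ _ (\sum_(0 <= j < k) k%:R ^+ 2 * a j)).
      rewrite big_nat_cond [leRHS]big_nat_cond; apply: ler_sum => j; rewrite andbT /= => jk.
      by rewrite ler_wpM2r // ler_pXn2r ?nnegrE ?ler0n // ler_nat ltnW.
    by rewrite -mulr_sumr ler_piMr ?sqr_ge0.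
  by rewrite -[in leLHS](add0n k) big_addn add0n addKn.
(* From (j - 2k)^2 >= 0 one gets (j + k)^2 / 2 <= 3/4 j^2 + 3/2 k^2. As 3/4 < 1, [V] is absorbed on
   the left, leaving V <= 4 (1 + 3/2) k^2 = 10 k^2. *)
have V_le2 : \sum_(0 <= j < M) (j + k)%:R ^+ 2 * a (j + k)%N <=
    3 / 4 * V + 3 / 2 * k%:R ^+ 2.
  apply: (@le_trans _ _ (\sum_(0 <= j < M) (3 / 4 * (j%:R ^+ 2 * a j) + 3 / 2 * k%:R ^+ 2 * a j))).
    apply: ler_sum => j _; rewrite natrD; have := half j; have := a_ge0 j.
    have := ler0n R j; have := ler0n R k; move: (j%:R : R) (k%:R : R) (a j) (a (j + k)%N) => x y u v.
    move=> y0 x0 u0 vu; apply: (@le_trans _ _ ((x + y) ^+ 2 * (u / 2))).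
      by rewrite ler_wpM2l ?sqr_ge0.
    have : 0 <= u * (x - 2 * y) ^+ 2 by rewrite mulr_ge0 ?sqr_ge0.
    nra.
  rewrite big_split /= -!mulr_sumr lerD2l ler_piMr ?a_sum //.
  by have := sqr_ge0 (k%:R : R); lra.
have : (k%:R : R) ^+ 2 <= K%:R ^+ 2 by rewrite ler_pXn2r ?nnegrE ?ler0n // ler_nat.
lra.
Qed.

(** * From words to the probabilities of the statement *)

Section LinearExtensions.
Context {d : Order.disp_t} (P : finPOrderType d).
Implicit Types (f : {ffun P -> 'I_#|P|}) (s : seq P).

Local Notation lex := (fun x y : P => (x <= y)%O).

Definition word_of f := sort (fun x y => (f x <= f y)%N) (enum P).

Lemma index_word_of f y : f \in linexts P -> index y (word_of f) = f y.
Proof.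
move=> /linextsP[fbij _]; set s := word_of f.
have us : uniq s by rewrite sort_uniq enum_uniq.
have fE : map (fun y => val (f y)) s = iota 0 #|P|.
  apply: (@irr_sorted_eq _ ltn ltn_trans ltnn); rewrite ?iota_ltn_sorted //.
    rewrite ltn_sorted_uniq_leq map_inj_uniq ?us /=; last first.
      by move=> a b /val_inj/(bij_inj fbij).
    rewrite sorted_map; apply: sort_sorted => a b; exact: leq_total.
  move=> i; rewrite mem_iota /=; apply/mapP/idP => [[a _ ->]|iP]; first exact: ltn_ord.
  have [g gK fK] := fbij; exists (g (Ordinal iP)); last by rewrite fK.
  by rewrite mem_sort mem_enum.
have ys : y \in s by rewrite mem_sort mem_enum.
rewrite -(index_map (f := fun y => val (f y))) ?fE; last first.
  by move=> a b /val_inj/(bij_inj fbij).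
have := @index_uniq _ 0%N (f y) (iota 0 #|P|); rewrite size_iota nth_iota ?ltn_ord //.
by apply; rewrite ?iota_uniq ?ltn_ord.
Qed.

Lemma perm_words_linexts : perm_eq (linear_words lex [set: P]) (map word_of (enum (linexts P))).
Proof.
have w_inj : {in linexts P &, injective word_of}.
  move=> f g fL gL E; apply/ffunP => y; apply: val_inj.
  by rewrite /= -(index_word_of y fL) E index_word_of.
apply: uniq_perm; first exact: linear_words_uniq.
  by rewrite map_inj_in_uniq ?enum_uniq // => f g; rewrite !mem_enum; exact: w_inj.
move=> s; apply/linear_wordsP/mapP => [[us sT ls]|[f]].
  have sz y : (index y s < #|P|)%N.
    have -> : #|P| = size s by rewrite -(card_uniqP us); apply: eq_card => c; rewrite sT !inE.
    by rewrite index_mem sT inE.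
  pose f := [ffun y => Ordinal (sz y)].
  have fL : f \in linexts P.
    rewrite inE; apply/andP; split.
      apply/injectiveP => a b /(congr1 val); rewrite !ffunE /= => E.
      have as_ : a \in s by rewrite sT inE.
      have bs : b \in s by rewrite sT inE.
      by rewrite -(nth_index a as_) E nth_index.
    apply/forallP => a; apply/forallP => b; apply/implyP => ab; rewrite !ffunE /=.
    have [->//|nab] := eqVneq a b; apply/ltnW/(@linear_word_index _ lex) => //; by rewrite sT inE.
  exists f; first by rewrite mem_enum.
  have szE : size s = size (word_of f).
    rewrite size_sort -cardE -(card_uniqP us); apply: eq_card => c.
    by rewrite sT !inE.
  case: s us sT ls sz @f fL szE => [|x0 s] us sT ls sz f fL szE.
    by apply/esym/size0nil; rewrite -szE.
  apply: (@eq_from_nth _ x0) => // i is_; set y := nth x0 (x0 :: s) i.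
  have yi : index y (word_of f) = i.
    by rewrite index_word_of // /f ffunE; exact: index_uniq.
  by rewrite -yi nth_index // mem_sort mem_enum.
move=> fL ->; rewrite mem_enum in fL.
have us : uniq (word_of f) by rewrite sort_uniq enum_uniq.
have yw y : y \in word_of f by rewrite mem_sort mem_enum.
split=> [//|y|]; first by rewrite yw !inE.
have key_tr : transitive (fun x y => (f x <= f y)%N) by move=> ? ? ?; exact: leq_trans.
have uws : pairwise (fun x y : P => x != y) (word_of f) by rewrite -uniq_pairwise.
have srt : pairwise (fun x y => (f x <= f y)%N) (word_of f).
  by rewrite -(sorted_pairwise key_tr); apply: sort_sorted => x y; exact: leq_total.
have : pairwise (fun x y => (f x <= f y)%N && (x != y)) (word_of f).
  by rewrite pairwise_relI srt uws.
apply: sub_pairwise => x y /andP[fxy nxy]; apply: contraNN nxy => yx.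
have /linextsP[fbij fmono] := fL.
apply/eqP/(bij_inj fbij)/val_inj/eqP; rewrite eqn_leq fxy /=; exact: fmono.
Qed.

Lemma sum_linexts (V : nmodType) (F : seq P -> V) :
  \sum_(f in linexts P) F (word_of f) = \sum_(s <- linear_words lex [set: P]) F s.
Proof. by rewrite (perm_big _ perm_words_linexts) big_map big_enum. Qed.

Lemma card_linexts_count (E : pred (seq P)) :
  #|[set f in linexts P | E (word_of f)]| = count E (linear_words lex [set: P]).
Proof.
rewrite (permP perm_words_linexts) count_map -sum1_count big_enum_cond /= -sum1_card.
by apply: eq_bigl => f; rewrite inE.
Qed.

Lemma card_linexts : #|linexts P| = size (linear_words lex [set: P]).
Proof. by rewrite (perm_size perm_words_linexts) size_map -cardE. Qed.

(** The constant map into a one-point chain preserves order, so the upper bound of [top_maps_upper]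
    at [N = 0] is positive. *)
Lemma linexts_gt0 : (0 < #|linexts P|)%N.
Proof.
rewrite card_linexts.
have := @top_maps_upper P lex (@lexx _ P) (@le_anti _ P) (@le_trans _ P) 0 [set: P].
have : (0 < #|top_maps lex 0 [set: P]|)%N.
  apply/card_gt0P; exists [ffun=> ord_max]; apply/top_mapsP.
  by split=> [a b _|a _]; rewrite !ffunE.
by rewrite -/(num_linext lex [set: P]) => /leq_trans h /h; rewrite muln_gt0 => /andP[].
Qed.

Variable R : realType.

Lemma prec_probE (x y : P) : prec_prob R x y =
  (count (fun s => index x s < index y s)%N (linear_words lex [set: P]))%:R / #|linexts P|%:R.
Proof.
rewrite /prec_prob /lin_prob; congr (_%:R / _).
rewrite -card_linexts_count; apply: eq_card => f; rewrite !inE.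
case: (boolP (f \in linexts P)) => [fL|]; last by rewrite inE => /negbTE->.
by rewrite !index_word_of.
Qed.

Lemma prec_probC (x y : P) : x != y -> prec_prob R x y + prec_prob R y x = 1.
Proof.
move=> xy; rewrite !prec_probE -mulrDl -natrD.
rewrite (_ : (_ + _)%N = #|linexts P|) ?divff ?pnatr_eq0 -?lt0n ?linexts_gt0 //.
rewrite card_linexts -[RHS](count_predC (fun s => index x s < index y s)%N).
congr (_ + _)%N; apply: eq_in_count => s sw /=; rewrite -leqNgt ltn_neqAle.
rewrite andb_idl // => _; apply: contraNneq xy => E.
by rewrite -(nth_index x (word_mem y sw)) E nth_index ?(word_mem x sw).
Qed.

Lemma sum_index_word (x : P) (g : nat -> R) :
  \sum_(f in linexts P) g (f x) = \sum_(0 <= k < #|P|) (position_count x lex [set: P] k)%:R * g k.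
Proof.
rewrite (eq_bigr (fun f => g (index x (word_of f)))) => [|f fL]; last by rewrite index_word_of.
rewrite (sum_linexts (fun s => g (index x s))) big_mkord.
rewrite (eq_big_seq (fun s => \sum_(k < #|P| | index x s == k) g k)) => [|s sw].
  rewrite (exchange_big_dep predT) //=; apply: eq_bigr => k _.
  by rewrite /position_count -sum1_count natr_sum mulr_suml; apply: eq_bigr => s _; rewrite mul1r.
have ix : (index x s < #|P|)%N.
  by rewrite -cardsT -(size_word sw) index_mem (word_mem x sw).
by rewrite (big_pred1 (Ordinal ix)) // => k; rewrite eq_sym.
Qed.

Lemma position_count_sum_le (x : P) M :
  (\sum_(0 <= k < M) position_count x lex [set: P] k <= #|linexts P|)%N.
Proof.
rewrite card_linexts; apply: leq_trans (count_size (fun s => index x s < M)%N _).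
rewrite eq_leq //; elim: M => [|M IH].
  by rewrite big_geq //; elim: (linear_words _ _) => //= s l <-.
rewrite big_nat_recr //= IH /position_count; elim: (linear_words _ _) => //= s l <-.
by rewrite addnACA; congr (_ + _)%N; rewrite [in RHS]ltnS; case: ltngtP.
Qed.

(** The two sides differ by the squared distance from [c] to the mean; so the spread may be measured
    from the atom, where the law is controlled. *)
Lemma sigma_le (x : P) (c : R) :
  sigma_elt R x ^+ 2 <= lin_expect (fun f => ((position f x)%:R - c) ^+ 2).
Proof.
have L_gt0 : 0 < #|linexts P|%:R :> R by rewrite ltr0n linexts_gt0.
rewrite sqr_sqrtr; last first.
  by rewrite divr_ge0 ?ler0n //; apply: sumr_ge0 => f _; exact: sqr_ge0.
rewrite /lin_expect ler_pM2r ?invr_gt0 //.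
set mu := mean_position R x; set X := fun f => (position f x)%:R : R.
have muE : \sum_(f in linexts P) X f = mu * #|linexts P|%:R.
  by rewrite /mu /mean_position /lin_expect mulfVK // gt_eqF.
rewrite -subr_ge0 -sumrB.
rewrite (eq_bigr (fun f => (mu - c) * (2 * X f) - (mu - c) * (c + mu))) => [|f _]; last first.
  by rewrite -/(X f); ring.
rewrite sumrB sumr_const -mulr_sumr -mulr_sumr muE -mulr_natr.
set N := _%:R : R in L_gt0 *.
rewrite (_ : _ - _ = (mu - c) ^+ 2 * N); last by ring.
by rewrite mulr_ge0 ?sqr_ge0 // ltW.
Qed.

(** The law is split at the atom into two tails, each starting with the mass at [m]. By
    [second_moment] each contributes at most [10 * K%:R ^+ 2], and 20 <= 5^2. *)
Lemma sigma_atom_le (x : P) (c : R) (K m : nat) : 0 < c -> 2 <= c * K%:R ->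
  c * #|linexts P|%:R <= (position_count x lex [set: P] m)%:R -> sigma_elt R x <= 5 * K%:R.
Proof.
move=> c_gt0 cK atom.
have L_gt0 : 0 < #|linexts P|%:R :> R by rewrite ltr0n linexts_gt0.
pose p k : R := (position_count x lex [set: P] k)%:R / #|linexts P|%:R.
have p_ge0 k : 0 <= p k by rewrite divr_ge0.
have cp : c <= p m by rewrite ler_pdivlMr.
have p_sum M : \sum_(0 <= k < M) p k <= 1.
  by rewrite -mulr_suml ler_pdivrMr // mul1r -natr_sum ler_nat position_count_sum_le.
have p_big k : (#|P| <= k)%N -> p k = 0.
  move=> nk; rewrite /p /position_count (eq_in_count (a2 := pred0)) ?count_pred0 ?mul0r // => s sw.
  apply/negbTE; rewrite neq_ltn; apply/orP; left; apply: leq_trans nk.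
  by rewrite -cardsT -(size_word sw) index_mem (word_mem x sw).
have m_lt : (m < #|P|)%N.
  by rewrite ltnNge; apply/negP => /p_big pm; move: cp; rewrite pm leNgt c_gt0.
have lc a b k : (a <= b)%N -> p a * p (b + k)%N <= p (a + k)%N * p b.
  move=> ab; have [nbk|bkn] := leqP #|P| (b + k)%N.
    by rewrite (p_big (b + k)%N) // mulr0 mulr_ge0.
  rewrite /p mulf_div [leRHS]mulf_div ler_pM2r ?invr_gt0 ?mulr_gt0 // -!natrM ler_nat.
  have [n nE] : exists n, #|P| = n.+1 by exists #|P|.-1; rewrite prednK //; lia.
  apply: (@position_count_log_concave R _ _ _ _ n _ _ _ (@lexx _ P) (@le_anti _ P) (@le_trans _ P)) => //.
    by rewrite cardsT.
  lia.
pose up j := p (m + j)%N.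
(* The cutoff matters: truncated subtraction would repeat [p 0] for all [j] beyond [m]. *)
pose dn j := if (j <= m)%N then p (m - j)%N else 0.
have up_le : forall M, \sum_(0 <= j < M) j%:R ^+ 2 * up j <= 10 * K%:R ^+ 2.
  apply: (@second_moment _ _ c) => //.
  - by move=> j; exact: p_ge0.
  - move=> M; apply: le_trans (p_sum (m + M)%N).
    rewrite [leRHS](big_cat_nat _ (n := m)) ?leq_addr //= -[X in _ + \sum_(X <= _ < _) _]add0n.
    rewrite big_addn addKn; under [X in _ + X]eq_bigr do rewrite addnC.
    by rewrite lerDr sumr_ge0.
  - by rewrite /up addn0.
  - move=> j k; rewrite /up addn0 mulrC addnA; apply: lc; exact: leq_addr.
have dn_le : forall M, \sum_(0 <= j < M) j%:R ^+ 2 * dn j <= 10 * K%:R ^+ 2.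
  have dn_ge0 j : 0 <= dn j by rewrite /dn; case: ifP.
  apply: (@second_moment _ _ c) => //.
  - move=> M; apply: le_trans (p_sum m.+1).
    apply: (@le_trans _ _ (\sum_(0 <= j < m.+1 + M) dn j)).
      by rewrite addnC [leRHS](big_cat_nat _ (n := M)) ?leq_addr //= lerDl sumr_ge0.
    rewrite (big_cat_nat _ (n := m.+1)) ?leq_addr //=.
    have -> : \sum_(m.+1 <= j < m.+1 + M) dn j = 0.
      by rewrite big_nat_cond big1 // => j /andP[/andP[mj _] _]; rewrite /dn leqNgt mj.
    rewrite addr0.
    rewrite [leRHS]big_nat_rev /= add0n big_nat_cond [leRHS]big_nat_cond.
    by apply: ler_sum => j; rewrite andbT /= ltnS /dn => ->; rewrite subSS.
  - by rewrite /dn subn0.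
  - move=> j k; rewrite {1 2}/dn leq0n subn0; case: ifP => jk; last by rewrite mul0r mulr_ge0.
    have -> : dn k * dn j = p (m - (j + k) + k)%N * p (m - k)%N.
      by rewrite /dn !ifT ?[dn _ * _]mulrC; [rewrite mulrC; congr (p _ * _); lia|lia|lia].
    have {2}-> : m = (m - k + k)%N by lia.
    by apply: lc; lia.
have : sigma_elt R x ^+ 2 <= 20 * K%:R ^+ 2.
  (* Positions start at 1 and indices at 0, so index [m] is position [m.+1]. *)
  apply: le_trans (sigma_le x m.+1%:R) _.
  rewrite /lin_expect.
  rewrite (eq_bigr (fun f => (fun k : nat => (k.+1%:R - m.+1%:R) ^+ 2) (f x))) //.
  rewrite (sum_index_word x (fun k : nat => (k.+1%:R - m.+1%:R) ^+ 2)) mulr_suml.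
  rewrite (big_cat_nat _ (n := m)) //=; last exact: ltnW.
  have -> : 20 * K%:R ^+ 2 = 10 * K%:R ^+ 2 + 10 * K%:R ^+ 2 :> R by ring.
  apply: lerD.
    apply: le_trans (dn_le m.+1); rewrite big_nat_rev add0n /= [leRHS]big_nat_recl //=.
    rewrite expr0n mul0r add0r big_nat_cond [leRHS]big_nat_cond.
    apply: ler_sum => j; rewrite andbT /= => jm.
    rewrite /dn jm /p [leLHS]mulrAC mulrC -[(m - j.+1).+1]addn1 -[m.+1]addn1 !natrD natrB //.
    by rewrite le_eqVlt; apply/orP; left; apply/eqP; ring.
  apply: le_trans (up_le (#|P| - m)%N).
  rewrite -{1}[m]add0n big_addn; apply: ler_sum => j _.
  rewrite /up /p addnC [leLHS]mulrAC mulrC -[(m + j).+1]addn1 -[m.+1]addn1 !natrD.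
  by rewrite le_eqVlt; apply/orP; left; apply/eqP; ring.
move=> s2; rewrite -(ler_pXn2r (n := 2)) ?nnegrE ?sqrtr_ge0 ?mulr_ge0 //.
apply: le_trans s2 _; rewrite exprMn ler_wpM2r ?sqr_ge0 //.
by rewrite -natrX ler_nat.
Qed.

End LinearExtensions.

(** * An atom from the absence of balanced pairs *)

Section Atom.
Context {d : Order.disp_t} (P : finPOrderType d).
Variables (R : realType) (x : P).
Implicit Types (D : {set P}) (X Y Z : pred {set P}).

Local Notation lex := (fun x y : P => (x <= y)%O).

Let L : R := #|linexts P|%:R.

Let L_gt0 : 0 < L.
Proof. by rewrite ltr0n linexts_gt0. Qed.

Definition below_prob X : R := (\sum_(D | X D) (below_count lex x D)%:R) / L.

Lemma below_probE X :
  below_prob X = (count (fun s => X (below_set x s)) (linear_words lex [set: P]))%:R / L.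
Proof. by rewrite /below_prob -natr_sum sum_below_count. Qed.

Lemma below_probT : below_prob predT = 1.
Proof. by rewrite below_probE count_predT -card_linexts divff // gt_eqF. Qed.

Lemma below_prob_mono X Y : (forall D, X D -> Y D) -> below_prob X <= below_prob Y.
Proof.
move=> XY; rewrite !below_probE ler_pM2r ?invr_gt0 // ler_nat.
by apply: sub_count => s; exact: XY.
Qed.

Lemma below_prob_predC X : below_prob (predC X) = 1 - below_prob X.
Proof.
apply/eqP; rewrite eq_sym subr_eq -below_probT; apply/eqP.
by rewrite /below_prob -mulrDl [in LHS](bigID X) /= addrC.
Qed.

Lemma below_prob_predI X Y : below_prob X + below_prob Y - 1 <= below_prob (predI X Y).
Proof.
rewrite -below_probT lerBlDr !below_probE -!mulrDl ler_pM2r ?invr_gt0 // -!natrD ler_nat.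
set W := linear_words _ _; rewrite -count_predUI addnC leq_add2l count_predT.
exact: count_size.
Qed.

Let below_count_lsm D D' : (below_count lex x D)%:R * (below_count lex x D')%:R <=
  (below_count lex x (D :|: D'))%:R * (below_count lex x (D :&: D'))%:R :> R.
Proof.
by rewrite -!natrM ler_nat; apply: below_count_supermodular; [exact: lexx|exact: le_anti|exact: le_trans].
Qed.

Let sumT : \sum_D (below_count lex x D)%:R = L.
Proof. by have := below_probT; rewrite /below_prob => /divr1_eq. Qed.

Lemma below_prob_meet X Y Z : (forall D D', X D -> Y D' -> Z (D :&: D')) ->
  below_prob X * below_prob Y <= below_prob Z.
Proof.
move=> XYZ; rewrite /below_prob mulf_div ler_pdivrMr ?mulr_gt0 //.
rewrite mulrA mulfVK ?gt_eqF // [leRHS]mulrC -sumT.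
exact: supermodular_meet.
Qed.

Lemma below_prob_join X Y Z : (forall D D', X D -> Y D' -> Z (D :|: D')) ->
  below_prob X * below_prob Y <= below_prob Z.
Proof.
move=> XYZ; rewrite /below_prob mulf_div ler_pdivrMr ?mulr_gt0 //.
rewrite mulrA mulfVK ?gt_eqF // [leRHS]mulrC -sumT.
exact: supermodular_join.
Qed.

(** One set is taken for each [b], and one more for [X] when [s] is exhausted, whence the exponent.
    In their intersection every [b] is avoided, and [X] is closed under intersection. *)
Lemma below_prob_avoid t X (s : seq P) : 0 <= t ->
  (forall D D', X D -> X D' -> X (D :&: D')) -> t <= below_prob X ->
  (forall b, b \in s -> t <= below_prob (fun D => X D && (b \notin D))) ->
  t ^+ (size s).+1 <= below_prob (fun D => X D && all (fun b => b \notin D) s).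
Proof.
move=> t_ge0 XI tX; elim: s => [|b s IH] ts /=.
  by rewrite expr1; apply: le_trans tX _; apply: below_prob_mono => D ->.
rewrite exprS; apply: le_trans (_ : below_prob (fun D => X D && (b \notin D)) *
   below_prob (fun D => X D && all (fun b => b \notin D) s) <= _).
  apply: ler_pM; rewrite ?exprn_ge0 ?ts ?mem_head //.
  by apply: IH => c cs; apply: ts; rewrite inE cs orbT.
apply: below_prob_meet => D D' /andP[XD bD] /andP[XD' /allP sD'].
rewrite XI // inE (negbTE bD) /=; apply/allP => c cs.
by rewrite inE negb_and (sD' c cs) orbT.
Qed.

(* The median operation [\bigcup_a \bigcap_b D_(a, b)], where [D_(a, b)] contains
   [a] and avoids [b], contains [r] and avoids [s]. *)
Lemma below_prob_separate t (r s : seq P) : 0 <= t <= 1 ->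
  (forall a, a \in r -> t <= below_prob (fun D => a \in D)) ->
  (forall b, b \in s -> t <= below_prob (fun D => b \notin D)) ->
  (forall a b, a \in r -> b \in s -> t <= below_prob (fun D => (a \in D) && (b \notin D))) ->
  t ^+ ((size s).+1 * (size r).+1) <=
  below_prob (fun D => all (fun b => b \notin D) s && all (fun a => a \in D) r).
Proof.
move=> /andP[t_ge0 t_le1] tr ts trs; rewrite exprM.
elim: r tr trs => [|a r IH] tr trs /=.
  rewrite expr1; apply: le_trans (below_prob_avoid (X := predT) t_ge0 _ _ _) _ => //.
    by rewrite below_probT.
  by apply: below_prob_mono => D /= ->.
rewrite exprS; apply: le_trans (_ : below_prob (fun D => (a \in D) && all (fun b => b \notin D) s) *
   below_prob (fun D => all (fun b => b \notin D) s && all (fun a => a \in D) r) <= _).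
  apply: ler_pM; rewrite ?exprn_ge0 //.
    apply: below_prob_avoid => //; first by move=> D D' aD aD'; rewrite inE aD.
      by apply: tr; exact: mem_head.
    by move=> b bs; apply: trs => //; exact: mem_head.
  apply: IH => [c cr|c b cr]; first by apply: tr; rewrite inE cr orbT.
  by apply: trs; rewrite inE cr orbT.
apply: below_prob_join => D D' /andP[aD /allP sD] /andP[/allP sD' /allP rD'].
rewrite inE aD /=; apply/andP; split; apply/allP => c cs.
  by rewrite inE negb_or sD // sD'.
by rewrite inE rD' // orbT.
Qed.

Lemma prec_prob_below y : prec_prob R y x = below_prob (fun D => y \in D).
Proof.
rewrite prec_probE below_probE; congr (_%:R / _).
by apply: eq_count => s; rewrite inE.
Qed.

Lemma card_below_set s : s \in linear_words lex [set: P] -> #|below_set x s| = index x s.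
Proof.
move=> sw; have /linear_wordsP[us _ _] := sw.
have <- : size (take (index x s) s) = index x s by rewrite size_takel // index_size.
have /card_uniqP <- : uniq (take (index x s) s) by rewrite take_uniq.
by apply: eq_card => y; rewrite inE in_take // (word_mem y sw).
Qed.

Lemma below_count_le_position_count D : (below_count lex x D <= position_count x lex [set: P] #|D|)%N.
Proof.
rewrite /below_count /position_count -!size_filter; apply: uniq_leq_size; first by rewrite filter_uniq ?linear_words_uniq.
move=> s; rewrite mem_filter => /andP[/eqP<- sw]; rewrite mem_filter sw andbT.
by rewrite card_below_set.
Qed.

Lemma antichain_width (A : {set P}) :
  (forall a b, a \in A -> b \in A -> (a <= b)%O -> a = b) -> (#|A| <= width P)%N.
Proof.
move=> anti; apply: (leq_bigmax_cond (F := fun A : {set P} => #|A|)).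
apply/forall_inP => a aA; apply/forall_inP => b bA; apply/implyP => ab.
by apply/negP => /orP[] h; move: ab; [rewrite (anti a b)|rewrite (anti b a)]; rewrite ?eqxx.
Qed.

Lemma atom_of_unbalanced (w : nat) eps : 0 < eps -> eps <= 1 / 2 ->
  (width P <= w)%N -> delta_elt R x <= 1 / 2 - eps ->
  exists m, (2 * eps) ^+ (w.+1 * w.+1) * L <= (position_count x lex [set: P] m)%:R.
Proof.
move=> eps_gt0 eps_le wP dx.
have gap y : y != x -> (prec_prob R y x <= 1 / 2 - eps) || (1 / 2 + eps <= prec_prob R y x).
  move=> yx; have : delta2 R x y <= 1 / 2 - eps.
    by apply: le_trans dx; exact: (le_bigmax_cond _ (fun y => delta2 R x y)).
  have := prec_probC R yx; rewrite /delta2 ge_min => pC /orP[] h; apply/orP; [right|left] => //.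
  lra.
pose A := [set y | (y != x) && (1 / 2 + eps <= prec_prob R y x)].
pose B := [set y | (y != x) && (prec_prob R y x <= 1 / 2 - eps)].
pose Amax := [set a in A | [forall a' in A, (a <= a')%O ==> (a' == a)]].
pose Bmin := [set b in B | [forall b' in B, (b' <= b)%O ==> (b' == b)]].
have Amax_w : (#|Amax| <= w)%N.
  apply: leq_trans wP; apply: antichain_width => a b; rewrite inE => /andP[aA /forall_inP amax].
  by rewrite inE => /andP[bA _] ab; apply/esym/eqP; exact: (implyP (amax b bA)).
have Bmin_w : (#|Bmin| <= w)%N.
  apply: leq_trans wP; apply: antichain_width => a b; rewrite inE => /andP[aB _].
  by rewrite inE => /andP[bB /forall_inP bmin] ab; apply/eqP; exact: (implyP (bmin a aB)).
exists #|A|.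
rewrite -ler_pdivlMr //.
apply: (@le_trans _ _ (below_prob (pred1 A))); last first.
  by rewrite /below_prob big_pred1_eq ler_pM2r ?invr_gt0 // ler_nat below_count_le_position_count.
have t01 : 0 <= 2 * eps <= 1 by apply/andP; split; lra.
have pA a : a \in enum Amax -> 1 / 2 + eps <= below_prob (fun D => a \in D).
  by rewrite mem_enum inE -prec_prob_below => /andP[+ _]; rewrite inE => /andP[].
have pB b : b \in enum Bmin -> 1 / 2 + eps <= below_prob (fun D => b \notin D).
  rewrite mem_enum inE => /andP[+ _]; rewrite inE prec_prob_below => /andP[_ pb].
  by rewrite (below_prob_predC (fun D => b \in D)); lra.
have := @below_prob_separate (2 * eps) (enum Amax) (enum Bmin) t01.
rewrite -!cardE => sep.
apply: (@le_trans _ _ ((2 * eps) ^+ (#|Bmin|.+1 * #|Amax|.+1))).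
  by apply: ler_wiXn2l; rewrite ?(andP t01).1 ?(andP t01).2 // leq_mul.
apply: (@le_trans _ _ (below_prob (fun D =>
   all (fun b => b \notin D) (enum Bmin) && all (fun a => a \in D) (enum Amax)))).
  apply: sep => [a /pA|b /pB|a b /pA pa /pB pb]; [lra|lra|].
  (* Two events of probability at least 1/2 + eps occur together with probability at least 2 eps. *)
  have := below_prob_predI (fun D => a \in D) (fun D => b \notin D).
  by rewrite /predI /= => h; apply: le_trans h; lra.
rewrite !below_probE ler_pM2r ?invr_gt0 // ler_nat -!size_filter.
apply: uniq_leq_size; first by rewrite filter_uniq ?linear_words_uniq.
move=> s; rewrite mem_filter => /andP[/andP[/allP noB /allP allA] sw]; rewrite mem_filter sw andbT /=.
have [xD dc _] := cut_below_set x sw.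
(* The set below [x] is down-closed, so it contains all elements below some member of [Amax] and
   none above a member of [Bmin]. By [gap] these are [A] and all other elements except [x]. *)
apply/eqP/setP => y; have [->|yx] := eqVneq y x.
  by rewrite (negbTE xD) !inE eqxx.
apply/idP/idP => [yD|yA].
  rewrite inE yx /=; case/orP: (gap y yx) => // py.
  have yB : y \in B by rewrite inE yx.
  have [b [bB by_ bmin]] := ex_minimal (@lexx _ P) (@le_anti _ P) (@le_trans _ P) yB.
  have /noB : b \in enum Bmin.
    rewrite mem_enum inE bB; apply/forall_inP => c cB; apply/implyP => cb.
    by apply/eqP; exact: bmin.
  by rewrite (dc _ _ by_ yD).
have [a [aA ya amax]] := ex_minimal (lex := fun u v : P => (v <= u)%O) (@lexx _ P)
  (fun u v h => le_anti (etrans (andbC _ _) h)) (fun u v t h1 h2 => le_trans h2 h1) yA.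
apply: dc ya _; apply: allA; rewrite mem_enum inE aA.
by apply/forall_inP => c cA; apply/implyP => ac; apply/eqP; exact: amax.
Qed.

End Atom.

(** * Conclusion *)

Lemma delta_elt_ge0 (d : Order.disp_t) (P : finPOrderType d) (R : realType) (x : P) :
  0 <= delta_elt R x.
Proof. exact: bigmax_ge_id. Qed.

Lemma delta_elt_le (d : Order.disp_t) (P : finPOrderType d) (R : realType) (x : P) :
  delta_elt R x <= delta_poset P R.
Proof.
apply/bigmax_leP; split; first exact: bigmax_ge_id.
move=> y yx; apply: (@le_bigmax_cond _ _ _ _ (x, y) (fun p : P * P => p.1 != p.2)
  (fun p => delta2 R p.1 p.2)).
by rewrite eq_sym.
Qed.

(** The mass [c] of the atom, and with it the bound, depends only on [w] and [eps]. For [eps] above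
    1/2 the claim is just that [delta_elt] is nonnegative. The sign of [S] is recorded for
    [sigma_poset], a maximum with default value 0. *)
Lemma balanced_of_large_sigma (R : realType) (w : nat) (eps : R) : 0 < eps ->
  exists2 S : R, 0 <= S & forall (d : Order.disp_t) (P : finPOrderType d),
    (width P <= w)%N -> forall x : P, S < sigma_elt R x -> 1 / 2 - eps < delta_elt R x.
Proof.
move=> eps_gt0; have [eps_le|eps_big] := lerP eps (1 / 2); last first.
  by exists 0 => // d P _ x _; apply: lt_le_trans (delta_elt_ge0 R x); lra.
pose c := (2 * eps) ^+ (w.+1 * w.+1).
have c_gt0 : 0 < c by rewrite exprn_gt0 // mulr_gt0.
pose K := Num.bound (2 / c).
have cK : 2 <= c * K%:R.
  rewrite mulrC -ler_pdivrMr //; apply/ltW/archi_boundP.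
  by rewrite divr_ge0 // ltW.
exists (5 * K%:R) => [|d P wP x sx]; first by rewrite mulr_ge0.
rewrite ltNge; apply/negP => dx.
have [m atom] := atom_of_unbalanced eps_gt0 eps_le wP dx.
by have := sigma_atom_le c_gt0 cK atom; rewrite leNgt sx.
Qed.

Theorem theorem1p5 (R : realType) (w : nat) (hw : (0 < w)%N) :
  (forall eps : R, 0 < eps ->
     exists S : R, forall (d : Order.disp_t) (P : finPOrderType d),
       (width P <= w)%N ->
       forall x : P, S < sigma_elt R x -> 1 / 2 - eps < delta_elt R x)
  /\
  (forall eps : R, 0 < eps ->
     exists S' : R, forall (d : Order.disp_t) (P : finPOrderType d),
       (width P <= w)%N ->
       S' < sigma_poset P R -> 1 / 2 - eps < delta_poset P R).
Proof.
split=> eps eps_gt0; have [S S_ge0 HS] := balanced_of_large_sigma w eps_gt0; exists S => d P wP.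
  exact: HS.
move=> sP; have [x sx] : exists x : P, S < sigma_elt R x.
  case: (boolP [exists x : P, S < sigma_elt R x]) => [/existsP//|].
  rewrite negb_exists => /forallP small; move: sP; rewrite ltNge => /negP[].
  by apply/bigmax_leP; split=> // x _; have := small x; rewrite -leNgt.
by apply: lt_le_trans (HS d P wP x sx) _; exact: delta_elt_le.
Qed.
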